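(* Let $d\ge1$ be fixed, let $k\ge1$, $m=kd$, and let $P_{2^m}$ follow the balanced-prefix random affine-tail model. There are constants $C_d>0$ and $k_0=k_0(d)$ such that, for every $k\ge k_0$ and every $1\le u\le k/4$, $$ \mathbb P\left(R_\infty(P_{2^m})<\frac{1}{8u}\,\frac{2^{-k}}{k}\right)\le C_du^{-d}, \qquad \mathbb P\left(R_\infty(P_{2^m})>8u\,\frac{2^{-k}}{k}\right)\le C_du^{-d}. $$ The bounds are uniform over all fixed matrices $B_1,\dots,B_d$ in the model (satisfying the invertibility condition of the model) and all digital shifts. In particular, as $k\to\infty$, $$ R_\infty(P_{2^m})=\Theta_{\mathbb P}\left(\frac{2^{-k}}{k}\right)=\Theta_{\mathbb P}\left(2^{-m/d}m^{-1}\right), \qquad h_\infty(P_{2^m})\asymp_d2^{-k}=2^{-m/d}, $$ and $$ \rho_\infty(P_{2^m})=\Theta_{\mathbb P}(k)=\Theta_{\mathbb P}(m). $$ Here $\asymp_d$ means two-sided bounds with positive constants depending only on $d$.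
   Context: Balanced-prefix random affine-tail model: fix $d,k\ge1$ and set $m=kd$. Let $B_1,\dots,B_d\in\mathbb F_2^{k\times m}$ be arbitrary deterministic matrices such that the $m\times m$ matrix $B$ obtained by stacking $B_1,\dots,B_d$ vertically is invertible over $\mathbb F_2$. Let $G_1,\dots,G_d\in\mathbb F_2^{\mathbb N\times m}$ be independent random matrices with independent uniform entries, and let $C_j\in\mathbb F_2^{\mathbb N\times m}$ be the matrix obtained by stacking $B_j$ on top of $G_j$ (the first $k$ rows of $C_j$ are those of $B_j$, followed by the rows of $G_j$). For each $j$ fix an arbitrary deterministic digital shift $\boldsymbol\delta_j\in\mathbb F_2^{\mathbb N}$. For a binary sequence $\boldsymbol y=(y_r)_{r\ge1}$ write $[\boldsymbol y]=\sum_{r\ge1}y_r2^{-r}$, and let $\oplus$ be componentwise addition in $\mathbb F_2$. For $\boldsymbol v\in\mathbb F_2^m$ put $x_{\boldsymbol v,j}=[C_j\boldsymbol v\oplus\boldsymbol\delta_j]$, $j=1,\dots,d$, and $P_{2^m}=(\boldsymbol x_{\boldsymbol v})_{\boldsymbol v\in\mathbb F_2^m}$. The only randomness comes from $G_1,\dots,G_d$. For an $N$-point multiset $P=(\boldsymbol x_n)$ in $[0,1]^d$ with $N\ge2$: $R_\infty(P)$ is the minimum of $\|\boldsymbol x_n-\boldsymbol x_{n'}\|_\infty$ over different indices, $h_\infty(P)=\sup_{\boldsymbol z\in[0,1]^d}\min_{n}\|\boldsymbol z-\boldsymbol x_n\|_\infty$, $\rho_\infty(P)=2h_\infty(P)/R_\infty(P)$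 ($=\infty$ if $R_\infty(P)=0$). Probabilistic order: $X_k=O_{\mathbb P}(a_k)$ means that for every $\varepsilon>0$ there are $C_\varepsilon>0$ and $k_\varepsilon$ with $\mathbb P(|X_k|>C_\varepsilon a_k)\le\varepsilon$ for all $k\ge k_\varepsilon$; $X_k=\Omega_{\mathbb P}(a_k)$ means $a_k/X_k=O_{\mathbb P}(1)$; $X_k=\Theta_{\mathbb P}(a_k)$ means both. *)

(* Defs.v *)
From HB Require Import structures.
From mathcomp Require Import all_boot all_order all_algebra.
From mathcomp Require Import all_classical all_reals all_analysis.

Set Implicit Arguments.
Unset Strict Implicit.
Unset Printing Implicit Defensive.

Import Order.TTheory GRing.Theory Num.Theory.
Import numFieldNormedType.Exports.

Local Open Scope classical_set_scope.
Local Open Scope ring_scope.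

Section Probability.
Context {R : realType}.

(* The finite type T carries the discrete sigma-algebra. *)
Definition discrete_rv (d : measure_display) (Omega : measurableType d)
    (T : finType) (X : Omega -> T) : Prop :=
  forall A : set T, measurable (X @^-1` A).

Definition mutually_independent (d : measure_display)
    (Omega : measurableType d) (P : probability Omega R)
    (I : eqType) (T : finType) (X : I -> Omega -> T) : Prop :=
  forall (s : seq I) (A : I -> set T), uniq s ->
    (P (\bigcap_(i in [set` s]) (X i @^-1` A i))
     = \prod_(i <- s) P (X i @^-1` A i))%E.

Definition uniformly_distributed (d : measure_display)
    (Omega : measurableType d) (P : probability Omega R)
    (T : finType) (X : Omega -> T) : Prop :=
  forall t : T, P (X @^-1` [set t]) = (#|T|%:R^-1 : R)%:E.

(* The k-th variable may live on its own probability space. *)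
Definition bigO_P (d : nat -> measure_display)
    (Omega : forall k, measurableType (d k))
    (P : forall k, probability (Omega k) R)
    (X : forall k, Omega k -> \bar R) (a : nat -> R) : Prop :=
  forall eps : R, 0 < eps ->
  exists (C : R) (k0 : nat), 0 < C /\ forall k, (k0 <= k)%N ->
    (P k [set w | `|X k w| > (C * a k)%:E] <= eps%:E)%E.

(* Extended-real division: a / 0 = +oo and a / +oo = 0 for a > 0. *)
Definition bigOmega_P (d : nat -> measure_display)
    (Omega : forall k, measurableType (d k))
    (P : forall k, probability (Omega k) R)
    (X : forall k, Omega k -> \bar R) (a : nat -> R) : Prop :=
  bigO_P P (fun k w => ((a k)%:E / X k w)%E) (fun=> 1).

Definition bigTheta_P (d : nat -> measure_display)
    (Omega : forall k, measurableType (d k))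
    (P : forall k, probability (Omega k) R)
    (X : forall k, Omega k -> \bar R) (a : nat -> R) : Prop :=
  bigO_P P X a /\ bigOmega_P P X a.

End Probability.

Section PointSets.
Context {R : realType} {d : nat} {T : finType}.
(* A multiset of #|T| points; on 'rV[R]_d the norm `|_| is the max norm. *)
Variable x : T -> 'rV[R]_d.

(* The infima over n and over pairs of indices are minima of finite sets,
   nonempty as soon as 1 < #|T|. *)
Definition separation : R :=
  inf [set `|x p.1 - x p.2| | p in [set p : T * T | p.1 != p.2]].

Definition unit_cube : set 'rV[R]_d :=
  [set z | forall j, 0 <= z ord0 j <= 1].

Definition covering_radius : R :=
  sup [set inf [set `|z - x n| | n in [set: T]] | z in unit_cube].

Definition mesh_ratio : \bar R :=
  if separation == 0 then +oo%E
  else (2 * covering_radius / separation)%:E.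

End PointSets.

(* Digits are indexed from 0, so y r has weight 2 ^- r.+1. *)
Definition binary_value {R : realType} (y : nat -> 'F_2) : R :=
  limn (series ((fun r => (y r : nat)%:R * 2 ^- r.+1) : R^nat)).

Section AffineTail.
Context {d k : nat}.

Lemma sum_blocks : (\sum_(j < d) k)%N = (k * d)%N.
Proof. by rewrite sum_nat_const card_ord mulnC. Qed.

Definition stacked (B : 'I_d -> 'M['F_2]_(k, k * d)) : 'M['F_2]_(k * d) :=
  castmx (sum_blocks, erefl) (\mxcol_(j < d) B j).

(* An N x m matrix is represented as the sequence of its rows. *)
Definition stack_rows (m : nat) (B : 'M['F_2]_(k, m))
    (G : nat -> 'rV['F_2]_m) : nat -> 'rV['F_2]_m :=
  fun r => if insub r is Some i then row i B else G (r - k)%N.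

Definition shifted_digits (m : nat) (C : nat -> 'rV['F_2]_m) (v : 'cV['F_2]_m)
    (delta : nat -> 'F_2) : nat -> 'F_2 :=
  fun r => (C r *m v) ord0 ord0 + delta r.

Definition tail_points {R : realType} (B : 'I_d -> 'M['F_2]_(k, k * d))
    (delta : 'I_d -> nat -> 'F_2) (G : 'I_d -> nat -> 'rV['F_2]_(k * d))
    (v : 'cV['F_2]_(k * d)) : 'rV[R]_d :=
  \row_j binary_value (shifted_digits (stack_rows (B j) (G j)) v (delta j)).

(* The digital shifts are arbitrary, hence unconstrained. *)
Definition affine_tail_model {R : realType} (dO : measure_display)
    (Omega : measurableType dO) (P : probability Omega R)
    (B : 'I_d -> 'M['F_2]_(k, k * d))
    (G : Omega -> 'I_d -> nat -> 'rV['F_2]_(k * d)) : Prop :=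
  let entry (i : 'I_d * nat * 'I_(k * d)) (w : Omega) : 'F_2 :=
    G w i.1.1 i.1.2 ord0 i.2 in
  [/\ stacked B \in unitmx,
      forall i, discrete_rv (entry i),
      forall i, uniformly_distributed P (entry i)
    & mutually_independent P entry].

End AffineTail.

(* Main.v *)
Require Import Defs.
From HB Require Import structures.
From mathcomp Require Import all_boot all_order all_algebra.
From mathcomp Require Import all_classical all_reals all_analysis measurable_realfun.
From mathcomp Require Import zify ring lra.

Set Implicit Arguments.
Unset Strict Implicit.
Unset Printing Implicit Defensive.

Import Order.TTheory GRing.Theory Num.Theory.
Import numFieldNormedType.Exports.

Local Open Scope ring_scope.

(** Write [L] for the number of tail rows under consideration.  Two reals whose
first [k + L] binary digits encode the integers [A] and [A'] are closer than
[2 ^- (k + L)] only if [A] and [A'] differ by at most one, and then their digits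
differ exactly on a final segment of positions: a carry flips a digit and all
the digits after it ([carry_pattern]).  In the model the digitwise difference of
[x_v] and [x_v'] depends on [w = v - v'] only and is linear in [w], so closeness
of two points is a statement about the single vector [w].

Lower tail.  If the separation is below [2 ^- (k + L)], the digits of some
nonzero [w] vanish before a position [a j] and equal one from [a j] on, in every
coordinate [j] ([close_pair_pattern]).  Since the stacked prefix matrix is
invertible, the first [k] digits determine [w], so only [(k + L + 1) ^ d]
vectors have to be considered, and each of them meets the requirement on its
[d * L] uniform tail bits with probability [2 ^- (d * L)].  The union bound
[((k + L + 1) / 2 ^ L) ^ d] with [2 ^ L] of the order of [u * k] is of the order
of [u ^- d].

Upper tail.  Conversely, let [a] satisfy [a j < k] for all [j], let [w] be the
vector whose prefix digits are one exactly from [a j] on, and suppose that its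
tail digits are all ones.  If moreover [x_v] has digit [0] at position [a j] and
then only ones up to position [k + L], adding [w] is a carry that replaces the
integer [A] by [A + 1] in every coordinate, so that [x_v] and [x_(v + w)] are
within [2 * 2 ^- (k + L)] ([carry_pair_close]).  The images of distinct nonzero
vectors over the two-element field under a uniform matrix are pairwise
independent, so Chebyshev's inequality ([second_moment], [card_miss]) bounds the
probability that no vector of a given set is sent to a given target by
[2 ^ (d * L)] over the size of the set.  This is used twice: for the
[(k - h) ^ d] vectors [w] with [h <= a j], where [h = k./2], and, for each such
[a], for the at least [2 ^ (h * d) - 1] admissible vectors [v].  With [2 ^ L] of
the order of [k / u] the first failure probability is of the order of [u ^- d];
the second one is exponentially small and survives the union over all [a].

Covering radius.  Every dyadic cell of side [2 ^- k] contains a point, whence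
the upper bound [2 ^- k]; the grid of mesh [2 ^- k] has [(2 ^ k + 1) ^ d] nodes,
more than there are points, and two nodes cannot share a point closer than
[2 ^- k / 2] to both, whence the lower bound.  The mesh ratio is then the inverse
of the separation up to constants.  Since a measure says nothing about sets that
are not measurable, all the events are shown to be measurable. *)

(** * Binary expansions and carries *)

Fixpoint prefix_value (y : nat -> 'F_2) (n : nat) : nat :=
  if n is n'.+1 then ((prefix_value y n').*2 + y n')%N else 0%N.

Lemma F2_cases (a : 'F_2) : a = 0 \/ a = 1.
Proof.
by case: a => [[|[|a]] //= a2]; [left|right]; apply/val_inj.
Qed.

Lemma F2_natE : (nat_of_ord (0 : 'F_2) = 0%N) * (nat_of_ord (1 : 'F_2) = 1%N).
Proof. by []. Qed.

Lemma prefix_value_ext (y z : nat -> 'F_2) n :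
  (forall r, (r < n)%N -> y r = z r) -> prefix_value y n = prefix_value z n.
Proof.
elim: n => //= n IHn yz; rewrite IHn ?yz // => r rn; apply: yz.
exact: ltnW.
Qed.

(** By induction on the number of digits: the new integer is twice the old one
plus the new digit, so two prefixes that differ by one either come from equal
prefixes, and then the flip starts at the new digit, or from prefixes that
differ by one, and then the new digits are forced to be [1] and [0]. *)
Lemma carry_pattern_aux (y z : nat -> 'F_2) n :
  (prefix_value y n = prefix_value z n ->
     forall r, (r < n)%N -> y r = z r) /\
  (prefix_value z n = (prefix_value y n).+1 ->
     exists2 a, (a < n)%N &
       forall r, (r < n)%N -> y r + z r = if (a <= r)%N then 1 else 0).
Proof.
elim: n => [|n [IHe IHs]]; first by split.
have ltS (Q : nat -> Prop) : (forall r, (r < n)%N -> Q r) -> Q n ->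
    forall r, (r < n.+1)%N -> Q r.
  by move=> H Hn r; rewrite ltnS leq_eqVlt => /orP[/eqP->|/H].
have add11 : 1 + 1 = 0 :> 'F_2 by apply/val_inj.
rewrite /=; case: (F2_cases (y n)) (F2_cases (z n)) => Hy [] Hz; rewrite Hy Hz !F2_natE.
- split=> [e|]; first by apply: ltS; [apply: IHe; lia|rewrite Hy Hz].
  by lia.
- split=> [|e]; first by lia.
  exists n => //; apply: ltS; last by rewrite leqnn Hy Hz add0r.
  move=> r rn; rewrite leqNgt rn /= IHe //; last by lia.
  by case: (F2_cases (z r)) => ->; rewrite ?add11 ?addr0.
- split=> [|e]; first by lia.
  have /IHs[a an Ha] : prefix_value z n = (prefix_value y n).+1 by lia.
  exists a; first exact: ltnW.
  by apply: ltS => //; rewrite Hy Hz (ltnW an) addr0.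
- split=> [e|]; last by lia.
  by apply: ltS; [apply: IHe; lia|rewrite Hy Hz].
Qed.

Lemma carry_pattern (y z : nat -> 'F_2) n :
  (prefix_value y n <= (prefix_value z n).+1)%N ->
  (prefix_value z n <= (prefix_value y n).+1)%N ->
  exists2 a, (a <= n)%N &
    forall r, (r < n)%N -> y r + z r = if (a <= r)%N then 1 else 0.
Proof.
move=> yz zy; have [e|e|e] : [\/ prefix_value y n = prefix_value z n,
    prefix_value z n = (prefix_value y n).+1
  | prefix_value y n = (prefix_value z n).+1].
- by have [?|?|?] := ltngtP (prefix_value y n) (prefix_value z n);
    [apply: Or32|apply: Or33|apply: Or31]; lia.
- exists n => // r rn; rewrite leqNgt rn (carry_pattern_aux y z n).1 //=.
  by case: (F2_cases (z r)) => ->; rewrite ?addr0 //; apply/val_inj.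
- have [a an H] := (carry_pattern_aux y z n).2 e.
  by exists a => //; exact: ltnW.
- have [a an H] := (carry_pattern_aux z y n).2 e.
  by exists a => [|r rn]; [exact: ltnW|rewrite addrC H].
Qed.

(** The converse of [carry_pattern], used to construct close points. *)
Lemma carry_succ (y z : nat -> 'F_2) a n : (a < n)%N ->
  y a = 0 -> (forall r, (a < r < n)%N -> y r = 1) ->
  (forall r, (r < n)%N -> z r = y r + if (a <= r)%N then 1 else 0) ->
  prefix_value z n = (prefix_value y n).+1.
Proof.
elim: n => // n IHn; rewrite ltnS leq_eqVlt => /orP[/eqP->|an] ya y1 zy /=.
  rewrite (zy n) // leqnn ya add0r !F2_natE.
  rewrite addn0 addn1; congr (_.*2.+1); apply: prefix_value_ext => r rn.
  by rewrite (zy _ (ltnW rn)) (leqNgt n r) rn addr0.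
rewrite IHn // => [|r /andP[ar rn]|r rn]; last by apply: zy; lia.
  have -> : z n = 0 by rewrite zy // (ltnW an) y1 ?an ?ltnS ?leqnn //; apply/val_inj.
  by rewrite y1 ?an ?ltnS ?leqnn // !F2_natE; lia.
by apply: y1; lia.
Qed.

Section BinaryValue.
Variables (R : realType) (y : nat -> 'F_2).

Let u : R^nat := fun r => (y r : nat)%:R * 2 ^- r.+1.

Let digit01 r : 0 <= ((y r : nat)%:R : R) <= 1.
Proof. by case: (F2_cases (y r)) => -> /=; rewrite lexx ler01. Qed.

Lemma partial_sum_prefix n : series u n = (prefix_value y n)%:R / 2 ^+ n.
Proof.
elim: n => [|n IHn]; first by rewrite seriesEnat /= big_geq // mul0r.
rewrite seriesSr IHn /u /= natrD -muln2 natrM exprS; field.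
by rewrite expf_neq0.
Qed.

Let tail_bound n N : (n <= N)%N ->
  series u n <= series u N <= series u n + 2 ^- n - 2 ^- N.
Proof.
elim: N => [|N IHN]; first by rewrite leqn0 => /eqP->; rewrite addrK lexx.
rewrite leq_eqVlt => /orP[/eqP->|]; first by rewrite addrK lexx.
rewrite ltnS => /IHN; rewrite seriesSr.
have -> : u N = (y N)%:R * 2 ^- N.+1 by [].
have /andP[d0 d1] := digit01 N.
have p : 0 < 2 ^- N.+1 :> R by rewrite invr_gt0 exprn_gt0.
have -> : 2 ^- N = 2 * 2 ^- N.+1 :> R.
  by rewrite exprS; field; rewrite expf_neq0.
have : 0 <= (y N)%:R * 2 ^- N.+1 :> R by rewrite mulr_ge0 // ltW.
have : (y N)%:R * 2 ^- N.+1 <= 1 * 2 ^- N.+1 :> R by rewrite ler_wpM2r // ltW.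
move: (series u n) (series u N) (2 ^- n) (2 ^- N.+1) ((y N)%:R * _).
by move=> a b c e f ? ? /andP[? ?]; apply/andP; split; lra.
Qed.

Lemma is_cvg_binary : cvgn (series u).
Proof.
apply: nondecreasing_is_cvgn; first by move=> n m /tail_bound/andP[].
exists 1 => _ [N _ <-]; have /andP[_] := tail_bound (leq0n N).
have : 0 < 2 ^- N :> R by rewrite invr_gt0 exprn_gt0.
rewrite expr0 invr1 {2}seriesEnat /= big_geq //; lra.
Qed.

Lemma binary_value_bounds n :
  (prefix_value y n)%:R / 2 ^+ n <= (binary_value y : R)
    <= ((prefix_value y n)%:R + 1) / 2 ^+ n.
Proof.
rewrite mulrDl mul1r -partial_sum_prefix; apply/andP; split.
- apply: limr_ge; first exact: is_cvg_binary.
  by near=> N; have /andP[] : series u n <= series u N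
    <= series u n + 2 ^- n - 2 ^- N by apply: tail_bound; near: N; exact: nbhs_infty_ge.
- apply: limr_le; first exact: is_cvg_binary.
  near=> N; have /andP[_] : series u n <= series u N
    <= series u n + 2 ^- n - 2 ^- N by apply: tail_bound; near: N; exact: nbhs_infty_ge.
  have : 0 < 2 ^- N :> R by rewrite invr_gt0 exprn_gt0.
  by rewrite /u; lra.
Unshelve. all: by end_near. Qed.

End BinaryValue.

(** Carry rigidity for reals. The strict inequality excludes prefixes that
differ by two, which could still meet at a common end point. *)
Lemma binary_value_close (R : realType) (y z : nat -> 'F_2) n :
  `|binary_value y - binary_value z| < 2 ^- n :> R ->
  exists2 a, (a <= n)%N &
    forall r, (r < n)%N -> y r + z r = if (a <= r)%N then 1 else 0.
Proof.
move=> h; have p : 0 < 2 ^+ n :> R by rewrite exprn_gt0.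
have /andP[y1 y2] := binary_value_bounds R y n.
have /andP[z1 z2] := binary_value_bounds R z n.
move: y1 y2 z1 z2; rewrite !ler_pdivlMr // !ler_pdivrMr // => y1 y2 z1 z2.
move: h; rewrite -[2 ^- n]mul1r ltr_pdivlMr // -{1}(gtr0_norm p) -normrM.
rewrite mulrBl ltr_norml => /andP[h1 h2].
by apply: carry_pattern; rewrite -ltnS -(ltr_nat R) -!natr1; lra.
Qed.

Lemma binary_value_dist_succ (R : realType) (y z : nat -> 'F_2) n :
  prefix_value z n = (prefix_value y n).+1 ->
  `|binary_value y - binary_value z| <= 2 * 2 ^- n :> R.
Proof.
move=> e; have /andP[y1 y2] := binary_value_bounds R y n.
have /andP[z1 z2] := binary_value_bounds R z n.
move: y1 y2 z1 z2; rewrite e -natr1 !mulrDl mul1r ler_norml => *; apply/andP; split; lra.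
Qed.

(** Digits are chosen greedily, from the most significant one; the closed
cells make the choice possible at [t = 1] too. *)
Lemma dyadic_cell (R : realType) (n : nat) (t : R) : 0 <= t <= 1 ->
  exists y : nat -> 'F_2,
    (prefix_value y n)%:R / 2 ^+ n <= t <= ((prefix_value y n)%:R + 1) / 2 ^+ n.
Proof.
move=> t01; elim: n => [|n [y /andP[y1 y2]]].
  by exists (fun=> 0) => /=; rewrite expr0 !divr1 add0r.
have p : 0 < 2 ^+ n :> R by rewrite exprn_gt0.
pose y' b r : 'F_2 := if (r < n)%N then y r else b.
have y'E b : prefix_value (y' b) n.+1 = ((prefix_value y n).*2 + b)%N.
  rewrite /= {2}/y' ltnn; congr (_.*2 + _)%N; apply: prefix_value_ext => r rn.
  by rewrite /y' rn.
move: y1 y2; rewrite ler_pdivrMr // ler_pdivlMr // => y1 y2.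
have [tm|tm] := leP (((prefix_value y n).*2)%:R + 1) (t * 2 ^+ n.+1);
  [exists (y' 1)|exists (y' 0)]; rewrite y'E F2_natE ?addn0 ?natrD
  ler_pdivrMr ?exprn_gt0 // ler_pdivlMr ?exprn_gt0 //;
  move: tm; rewrite exprS -!muln2 !natrM => tm; apply/andP; split; lra.
Qed.

(** * Uniform matrices over the two-element field *)

(** A right multiplication by a matrix with a left inverse is onto, and its
fibres are translates of each other; in probabilistic terms, the image of a
uniform matrix is uniform. *)
Lemma card_linear_fiber (F : finFieldType) (q m n : nat) (V : 'M[F]_(m, n))
    (Y : 'M[F]_(q, n)) : row_full V ->
  (#|[set H : 'M[F]_(q, m) | H *m V == Y]| * #|{: 'M[F]_(q, n)}|
   = #|{: 'M[F]_(q, m)}|)%N.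
Proof.
case/row_fullP => U UV.
have fiber0 Z : #|[set H : 'M[F]_(q, m) | H *m V == Z]|
    = #|[set H : 'M[F]_(q, m) | H *m V == 0]|.
  rewrite -[RHS](card_imset _ (addIr (Z *m U))); apply: eq_card => H; rewrite !inE.
  apply/idP/imsetP => [/eqP HV|[K]]; last first.
    by rewrite inE => /eqP KV ->; rewrite mulmxDl KV add0r -mulmxA UV mulmx1.
  exists (H - Z *m U); last by rewrite subrK.
  by rewrite inE mulmxBl HV -mulmxA UV mulmx1 subrr.
rewrite fiber0 mulnC -sum_nat_const.
rewrite -[RHS]sum1_card (partition_big (fun H => H *m V) predT) //=.
apply: eq_bigr => Z _; rewrite -(fiber0 Z) -sum1_card.
by apply: eq_bigl => H; rewrite inE.
Qed.

Lemma row_full_col1 (m : nat) (v : 'cV['F_2]_m) : v != 0 -> row_full v.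
Proof.
move=> v0; rewrite /row_full eqn_leq rank_leq_col lt0n mxrank_eq0.
exact: v0.
Qed.

(** Over the two-element field distinct nonzero vectors are linearly
independent; this is the source of all pairwise independence below. *)
Lemma row_full_col2 (m : nat) (v w : 'cV['F_2]_m) :
  v != 0 -> w != 0 -> v != w -> row_full (row_mx v w).
Proof.
move=> v0 w0 vw; rewrite -[row_full _]/(\rank _ == _) -mxrank_tr.
apply: inj_row_free => c; rewrite -[c]hsubmxK tr_row_mx mul_row_col.
rewrite [lsubmx c]mx11_scalar [rsubmx c]mx11_scalar !mul_scalar_mx.
move: (lsubmx c _ _) (rsubmx c _ _) => a b.
have tr0 (x : 'cV['F_2]_m) : x^T = 0 -> x = 0.
  by move=> e; rewrite -[x]trmxK e trmx0.
case: (F2_cases a) (F2_cases b) => -> [] ->; rewrite ?scale0r ?scale1r ?add0r ?addr0.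
- by rewrite !raddf0 row_mx0.
- by move=> /tr0 e; rewrite e eqxx in w0.
- by move=> /tr0 e; rewrite e eqxx in v0.
- move=> /eqP; rewrite addr_eq0 => /eqP e; exfalso; move/eqP: vw; apply.
  apply: trmx_inj; rewrite e; apply/matrixP => i j; rewrite !mxE.
  by case: (F2_cases (w j i)) => ->; apply/val_inj.
Qed.

Lemma card_M2 (q n : nat) : #|{: 'M['F_2]_(q, n)}| = (2 ^ (q * n))%N.
Proof. by rewrite card_mx card_Fp. Qed.

Lemma card_hit1 (q m : nat) (v : 'cV['F_2]_m) (Y : 'cV['F_2]_q) : v != 0 ->
  (#|[set H : 'M['F_2]_(q, m) | H *m v == Y]| * 2 ^ q
   = #|{: 'M['F_2]_(q, m)}|)%N.
Proof.
by move=> /row_full_col1/(@card_linear_fiber _ q _ _ _ Y); rewrite (card_M2 q 1) muln1.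
Qed.

Lemma card_hit2 (q m : nat) (v w : 'cV['F_2]_m) (Y : 'cV['F_2]_q) :
  v != 0 -> w != 0 -> v != w ->
  (#|[set H : 'M['F_2]_(q, m) | (H *m v == Y) && (H *m w == Y)]| * (2 ^ q) ^ 2
   = #|{: 'M['F_2]_(q, m)}|)%N.
Proof.
move=> v0 w0 vw.
have := @card_linear_fiber _ q _ _ _ (row_mx Y Y) (row_full_col2 v0 w0 vw).
rewrite (card_M2 q (1 + 1)) -expnM => <-; congr (_ * _)%N; apply: eq_card => H.
rewrite !inE mul_mx_row; apply/andP/eqP => [[/eqP-> /eqP->]//|].
by move=> /eq_row_mx[-> ->].
Qed.

(** Chebyshev's inequality, without division: if the events [E i] have
probability [1 / Q] and are pairwise independent, the number [N] of events
that occur has variance at most [#|S| / Q], while [N = 0] is a deviation of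
[#|S| / Q] from the mean. *)
Lemma second_moment (T I : finType) (E : I -> {set T}) (S : {set I}) (Q : nat) :
  (0 < Q)%N ->
  (forall i, i \in S -> #|E i| * Q = #|T|)%N ->
  (forall i j, i \in S -> j \in S -> i != j ->
     #|E i :&: E j| * Q ^ 2 = #|T|)%N ->
  (#|[set t | [forall (i | i \in S), t \notin E i]]| * #|S| <= Q * #|T|)%N.
Proof.
move=> Q0 E1 E2; have [->|[i0 i0S]] := set_0Vmem S; first by rewrite cards0 muln0.
have S0 : (0 < #|S|)%N by apply/card_gt0P; exists i0.
set A := [set t | _]; pose N t : int := \sum_(i in S) ((t \in E i)%:R : int).
pose n : int := #|S|%:R; pose q : int := Q%:R; pose M : int := #|T|%:R.
have card_sum (B : {set T}) : \sum_t ((t \in B)%:R : int) = #|B|%:R.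
  by rewrite -sum1_card natr_sum [RHS]big_mkcond; apply: eq_bigr => t _; case: (t \in B).
(* First and second moments of [N], cleared of denominators. *)
have s1 : q * (\sum_t N t) = n * M.
  rewrite exchange_big mulr_sumr /= (eq_bigr (fun=> M)).
    by rewrite sumr_const -mulr_natl.
  by move=> i iS; rewrite card_sum -natrM mulnC E1.
have s2 : q ^+ 2 * (\sum_t N t ^+ 2) = n * (q * M + (n - 1) * M).
  have -> : \sum_t N t ^+ 2 = \sum_(i in S) \sum_(j in S) #|E i :&: E j|%:R.
    rewrite (eq_bigr (fun t => \sum_(i in S) \sum_(j in S) ((t \in E i :&: E j)%:R : int))).
      rewrite exchange_big; apply: eq_bigr => i _; rewrite exchange_big.
      by apply: eq_bigr => j _; rewrite card_sum.
    move=> t _; rewrite expr2 big_distrl; apply: eq_bigr => i _; rewrite big_distrr.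
    by apply: eq_bigr => j _ /=; rewrite inE -natrM mulnb.
  rewrite mulr_sumr (eq_bigr (fun=> q * M + (n - 1) * M)).
    by rewrite sumr_const -mulr_natl.
  move=> i iS; rewrite (bigD1 i) //= finset.setIid mulrDr; congr (_ + _).
    by rewrite expr2 -mulrA; congr (_ * _); rewrite -natrM mulnC E1.
  rewrite mulr_sumr (eq_bigr (fun=> M)); last first.
    by move=> j /andP[jS ji]; rewrite -natrX -natrM mulnC E2 // eq_sym.
  rewrite sumr_const -mulr_natl; congr (_ * _).
  rewrite /n (cardD1 i S) iS natrD addrAC subrr add0r; congr (_%:R).
  by apply: eq_card => j; rewrite !inE andbC.
(* An outcome outside all the events contributes [n ^ 2] to the sum of squares. *)
have low : (#|A|%:R : int) * n ^+ 2 <= \sum_t (q * N t - n) ^+ 2.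
  rewrite -card_sum mulr_suml; apply: ler_sum => t _.
  have [|_] := boolP (t \in A); last by rewrite mul0r sqr_ge0.
  rewrite inE => /forall_inP tA; rewrite mul1r /N big1 => [|i /tA/negbTE->] //.
  by rewrite mulr0 sub0r sqrrN.
have expand : \sum_t (q * N t - n) ^+ 2 = n * M * (q - 1).
  rewrite (eq_bigr (fun t => q ^+ 2 * N t ^+ 2 - (2 * n) * (q * N t) + n ^+ 2)).
    have cT : \sum_(t : T) n ^+ 2 = n ^+ 2 * M by rewrite sumr_const -mulr_natr.
    rewrite big_split sumrB /= cT -!mulr_sumr s1 s2.
    by move: (M) (n) (q) => ? ? ?; ring.
  by move=> t _; move: (N t) (n) (q) => ? ? ?; ring.
have n0 : 0 < n by rewrite ltr0n.
have M0 : 0 <= M by rewrite ler0n.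
have {}low : (#|A|%:R : int) * n <= q * M.
  rewrite -(ler_pM2r n0) -mulrA -expr2 (le_trans low) // expand.
  rewrite -subr_ge0; have -> : q * M * n - n * M * (q - 1) = n * M.
    by move: (M) (n) (q) => ? ? ?; ring.
  by rewrite mulr_ge0 // ltW.
by move: low; rewrite -!natrM ler_nat.
Qed.

(** Pairwise independence of the images of distinct nonzero vectors makes a
large set of vectors unlikely to miss a target. *)
Lemma card_miss (q m : nat) (S : {set 'cV['F_2]_m}) (Y : 'cV['F_2]_q) :
  0 \notin S ->
  (#|[set H : 'M['F_2]_(q, m) | [forall (v | v \in S), H *m v != Y]]| * #|S|
   <= 2 ^ q * #|{: 'M['F_2]_(q, m)}|)%N.
Proof.
move=> S0; have nz v : v \in S -> v != 0 by apply: contraTneq => ->.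
pose E (v : 'cV['F_2]_m) := [set H : 'M['F_2]_(q, m) | H *m v == Y].
have := @second_moment _ _ E S (2 ^ q); rewrite expn_gt0.
suff -> : [set t | [forall (i | i \in S), t \notin E i]] =
  [set H | [forall (v | v \in S), H *m v != Y]].
  apply=> // [v vS|v w vS wS vw]; first by rewrite card_hit1 ?nz.
  rewrite -(@card_hit2 q m v w Y) ?nz //; congr (_ * _)%N.
  by apply: eq_card => H; rewrite !inE.
by apply/setP => H; rewrite !inE; apply: eq_forallb => v; rewrite inE.
Qed.

Local Open Scope classical_set_scope.
Local Open Scope ring_scope.

(** * The prefix matrices and the digits of the points *)

Section Blocks.
Variables (d k : nat) (B : 'I_d -> 'M['F_2]_(k, k * d)).
Hypothesis unitB : stacked B \in unitmx.

(** Stated for an arbitrary equality of dimensions, so that the cast in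
[stacked] can be eliminated. *)
Lemma castmx_unit_bijective (n m p : nat) (e : n = m) (X : 'M['F_2]_(n, m)) :
  castmx (e, erefl) X \in unitmx ->
  (forall v : 'M['F_2]_(m, p), X *m v = 0 -> v = 0) /\
  (forall b : 'M['F_2]_(n, p), exists v : 'M['F_2]_(m, p), X *m v = b).
Proof.
case: _ / e X => X; rewrite castmx_id => uX; split=> [v Xv|b].
  by rewrite -[v](mulKmx uX) Xv mulmx0.
by exists (invmx X *m b); rewrite mulKVmx.
Qed.

Lemma blocks_inj (v : 'cV['F_2]_(k * d)) : (forall j, B j *m v = 0) -> v = 0.
Proof.
move=> Bv; apply: (castmx_unit_bijective 1 unitB).1.
rewrite mxcol_mul; apply/mxcolP => j; rewrite mxcolK Bv submxcol0 //.
Qed.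

Lemma blocks_surj (b : 'I_d -> 'cV['F_2]_k) :
  exists v : 'cV['F_2]_(k * d), forall j, B j *m v = b j.
Proof.
have [v Xv] := (castmx_unit_bijective 1 unitB).2 (\mxcol_j b j).
by exists v => j; move/(congr1 (fun M => submxcol M j)): Xv;
  rewrite mxcol_mul !mxcolK.
Qed.

(** The prefixes of the [d] coordinates can be prescribed freely and determine
the vector. *)
Definition block_solution (b : 'I_d -> 'cV['F_2]_k) : 'cV['F_2]_(k * d) :=
  projT1 (cid (blocks_surj b)).

Lemma block_solutionE b j : B j *m block_solution b = b j.
Proof. exact: (projT2 (cid (blocks_surj b))). Qed.

Lemma block_solution_unique b v :
  (forall j, B j *m v = b j) -> v = block_solution b.
Proof.
move=> Bv; apply/subr0_eq/blocks_inj => j.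
by rewrite mulmxBr Bv block_solutionE subrr.
Qed.

End Blocks.

Section Digits.
Variables (d k : nat) (B : 'I_d -> 'M['F_2]_(k, k * d)).
Variables (delta : 'I_d -> nat -> 'F_2) (G : 'I_d -> nat -> 'rV['F_2]_(k * d)).

Definition rows (j : 'I_d) : nat -> 'rV['F_2]_(k * d) := stack_rows (B j) (G j).

Definition digits (v : 'cV['F_2]_(k * d)) (j : 'I_d) : nat -> 'F_2 :=
  shifted_digits (rows j) v (delta j).

Lemma rows_head j (v : 'cV['F_2]_(k * d)) (r : 'I_k) :
  (rows j r *m v) ord0 ord0 = (B j *m v) r ord0.
Proof.
rewrite /rows /stack_rows insubT //= => rk; rewrite -row_mul mxE.
by congr (fun_of_matrix _ _ ord0); apply/val_inj.
Qed.

Lemma rows_tail j s : rows j (k + s)%N = G j s.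
Proof. by rewrite /rows /stack_rows insubN ?addKn // -leqNgt leq_addr. Qed.

(** Over the two-element field the digital shift cancels in the digitwise
difference, which is therefore linear in the difference of the indices. *)
Lemma digitsD (v w : 'cV['F_2]_(k * d)) j r :
  digits (v + w) j r = digits v j r + (rows j r *m w) ord0 ord0.
Proof. by rewrite /digits /shifted_digits mulmxDr mxE addrAC. Qed.

End Digits.

(** * Separation and covering radius of a finite family of points *)

Lemma row_norm_le (R : realType) (d : nat) (x : 'rV[R]_d) (c : R) :
  0 <= c -> (forall j, `|x ord0 j| <= c) -> `|x| <= c.
Proof.
move=> c0 xc; rewrite [`|x|]mx_normrE; apply: bigmax_le => // -[i j] _ /=.
by rewrite (ord1 i).
Qed.

Lemma row_coord_le (R : realType) (d : nat) (x : 'rV[R]_d) j :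
  `|x ord0 j| <= `|x|.
Proof. by rewrite [`|x|]mx_normrE; exact: (le_bigmax _ _ (ord0, j)). Qed.

Section Separation.
Context {R : realType} {d : nat} {T : finType}.
Variable x : T -> 'rV[R]_d.

Lemma separation_le p q : p != q -> separation x <= `|x p - x q|.
Proof.
move=> pq; apply: ge_inf; last by exists (p, q).
by exists 0 => _ [r _ <-].
Qed.

Hypothesis T2 : (1 < #|T|)%N.

Lemma has_pair : exists p : T * T, p.1 != p.2.
Proof. by have /card_gt1P[p [q [_ _ pq]]] := T2; exists (p, q). Qed.

Lemma separation_lt_pair c : separation x < c ->
  exists p q, p != q /\ `|x p - x q| < c.
Proof.
move=> /inf_lt[]; first by have [p p12] := has_pair; exists `|x p.1 - x p.2|, p.
by move=> _ [[p q] /= pq <-] ?; exists p, q.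
Qed.

Lemma separation_ge0 : 0 <= separation x.
Proof.
rewrite leNgt; apply/negP => /separation_lt_pair[p [q [_]]].
by rewrite ltNge normr_ge0.
Qed.

End Separation.

Section Covering.
Context {R : realType} {d : nat} {T : finType}.
Variable x : T -> 'rV[R]_d.

Let nearest (z : 'rV[R]_d) : R := inf [set `|z - x n| | n in [set: T]].

Let nearest_le z n : nearest z <= `|z - x n|.
Proof. by apply: ge_inf; [exists 0 => _ [m _ <-]|exists n]. Qed.

Lemma nearest_ge (n0 : T) z c : (forall n, c <= `|z - x n|) -> c <= nearest z.
Proof.
by move=> cz; apply: lb_le_inf; [exists `|z - x n0|, n0|move=> _ [n _ <-]].
Qed.

Lemma nearest_lt (n0 : T) z c : nearest z < c -> exists n, `|z - x n| < c.
Proof.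
by move=> /inf_lt[|_ [n _ <-] ?]; [exists `|z - x n0|, n0|exists n].
Qed.

Variable c : R.
Hypothesis cover_c : forall z, unit_cube z -> exists n, `|z - x n| <= c.

Lemma covering_radius_le : covering_radius x <= c.
Proof.
apply: ge_sup => [|_ [z /cover_c[n zn] <-]]; last exact: le_trans (nearest_le z n) zn.
by exists (nearest 0), 0 => // j; rewrite mxE lexx ler01.
Qed.

Lemma nearest_le_covering z : unit_cube z -> nearest z <= covering_radius x.
Proof.
move=> zc; apply: ub_le_sup; last by exists z.
by exists c => _ [w /cover_c[n wn] <-]; exact: le_trans (nearest_le w n) wn.
Qed.

Lemma covering_radius_gt b :
  b < covering_radius x <-> exists2 z, unit_cube z & b < nearest z.
Proof.
split=> [/sup_gt[]|[z zc bz]]; last exact: lt_le_trans (nearest_le_covering zc).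
  by exists (nearest 0), 0 => // j; rewrite mxE lexx ler01.
by move=> _ [z zc <-] ?; exists z.
Qed.

(** Pigeonhole on the grid of mesh [1 / K]: a point closer than half the mesh
to two nodes would force these nodes to coincide. *)
Lemma covering_radius_ge (K : nat) : (0 < K)%N -> (#|T| < K.+1 ^ d)%N ->
  (2 * K%:R)^-1 <= covering_radius x.
Proof.
move=> K0 cardT; rewrite leNgt; apply/negP => small.
have K0' : 0 < K%:R :> R by rewrite ltr0n.
pose z (f : {ffun 'I_d -> 'I_K.+1}) : 'rV[R]_d := \row_j ((f j)%:R / K%:R).
have zc f : unit_cube (z f).
  move=> j; rewrite mxE divr_ge0 ?ler0n //= ler_pdivrMr // mul1r ler_nat.
  by rewrite -ltnS.
have close f : exists n, `|z f - x n| < (2 * K%:R)^-1.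
  have [n0 _] := cover_c (zc f).
  by apply: (nearest_lt n0); apply: le_lt_trans small; exact: nearest_le_covering.
pose g f := projT1 (cid (close f)).
have gP f : `|z f - x (g f)| < (2 * K%:R)^-1 by exact: (projT2 (cid (close f))).
(* Nodes served by the same point are closer than the mesh. *)
have g_inj : injective g.
  move=> f1 f2 g12; apply/ffunP => j; apply/val_inj/eqP; rewrite eqn_leq /=.
  have : `|z f1 - z f2| < K%:R^-1.
    rewrite -[z f1](subrK (x (g f1))) -addrA (le_lt_trans (ler_normD _ _)) //.
    have -> : K%:R^-1 = (2 * K%:R)^-1 + (2 * K%:R)^-1 :> R.
      by field; rewrite lt0r_neq0.
    by rewrite ltrD // {1}g12 distrC.
  move=> /(le_lt_trans (row_coord_le _ j)); rewrite !mxE -mulrBl normrM.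
  rewrite (@ger0_norm _ K%:R^-1) ?invr_ge0 ?ler0n //.
  rewrite -[ltRHS]mul1r ltr_pM2r ?invr_gt0 // ltr_norml => /andP[h1 h2].
  by rewrite -!(ltnS (_ (_ _))) -!(ltr_nat R) -!natr1; apply/andP; split; lra.
move: cardT; rewrite ltnNge -{1}[K.+1]card_ord -{1}(card_ord d) -card_ffun.
by rewrite (leq_card _ g_inj).
Qed.

End Covering.

Section CoveringOfTail.
Variables (R : realType) (d k : nat) (B : 'I_d -> 'M['F_2]_(k, k * d)).
Variables (delta : 'I_d -> nat -> 'F_2) (G : 'I_d -> nat -> 'rV['F_2]_(k * d)).
Hypothesis unitB : stacked B \in unitmx.
Let x : _ -> 'rV[R]_d := tail_points B delta G.

Lemma cell_has_point z : unit_cube z -> exists v, `|z - x v| <= 2 ^- k.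
Proof.
move=> zc; pose y j := projT1 (cid (dyadic_cell k (zc j))).
have yP j := projT2 (cid (dyadic_cell k (zc j))).
pose v := block_solution unitB (fun j => \col_r (y j r + delta j r)).
exists v; apply: row_norm_le => [|j]; first by rewrite invr_ge0 exprn_ge0.
rewrite !mxE -/(digits B delta G v j).
have e : prefix_value (digits B delta G v j) k = prefix_value (y j) k.
  apply: prefix_value_ext => r rk; rewrite /digits /shifted_digits.
  rewrite (rows_head B G j v (Ordinal rk)) block_solutionE mxE /= -addrA.
  by case: (F2_cases (delta j r)) => ->; rewrite ?addr0 //; apply/val_inj;
    case: (F2_cases (y j r)) => ->.
have /andP[y1 y2] := yP j; rewrite -/(y j) -e in y1 y2.
have /andP[x1 x2] := binary_value_bounds R (digits B delta G v j) k.
move: y1 y2 x1 x2; rewrite mulrDl mul1r ler_norml => *.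
by apply/andP; split; lra.
Qed.

Lemma card_index : #|{: 'cV['F_2]_(k * d)}| = ((2 ^ k) ^ d)%N.
Proof. by rewrite card_M2 muln1 expnM. Qed.

Lemma covering_radius_bounds : (0 < d)%N ->
  2 ^- k / 2 <= covering_radius x <= 2 ^- k.
Proof.
move=> d0; rewrite (covering_radius_le cell_has_point) andbT.
have := @covering_radius_ge _ _ _ x _ cell_has_point (2 ^ k).
rewrite card_index expn_gt0 ltn_exp2r // ltnSn => /(_ isT isT).
by rewrite natrX invfM mulrC.
Qed.

End CoveringOfTail.

(** * Digit patterns of close pairs *)

(** The digits flipped by a carry that starts at position [a]. *)
Definition step (a r : nat) : 'F_2 := if (a <= r)%N then 1 else 0.

(** The first [L] random rows of all the coordinates, gathered in one matrix
so that all the relevant randomness is a single uniform element of a finite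
space. Its rows are indexed by the pairs (coordinate, tail position). *)
Definition tail_matrix (d k L : nat) (G : 'I_d -> nat -> 'rV['F_2]_(k * d)) :
    'M['F_2]_(#|{: 'I_d * 'I_L}|, k * d) :=
  \matrix_(i < #|{: 'I_d * 'I_L}|, c < k * d) G (enum_val i).1 (enum_val i).2 ord0 c.

Definition tail_target (d L : nat) (f : 'I_d -> nat -> 'F_2) :
    'cV['F_2]_(#|{: 'I_d * 'I_L}|) :=
  \col_(i < #|{: 'I_d * 'I_L}|) f (enum_val i).1 (enum_val i).2.

Lemma tail_matrixP (d k L : nat) (G : 'I_d -> nat -> 'rV['F_2]_(k * d))
    (v : 'cV['F_2]_(k * d)) (f : 'I_d -> nat -> 'F_2) :
  tail_matrix L G *m v = tail_target L f <->
  forall j s, (s < L)%N -> (G j s *m v) ord0 ord0 = f j s.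
Proof.
have rowE i : (tail_matrix L G *m v) i ord0
    = (G (enum_val i).1 (enum_val i).2 *m v) ord0 ord0.
  by rewrite !mxE; apply: eq_bigr => c _; rewrite mxE.
split=> [H j s sL|H]; last first.
  by apply/matrixP => i c; rewrite (ord1 c) rowE H // mxE.
have := congr1 (fun M : 'cV_ _ => M (enum_rank (j, Ordinal sL)) ord0) H.
by rewrite /= rowE [RHS]mxE !enum_rankK.
Qed.

Section Patterns.
Variables (R : realType) (d k L : nat) (B : 'I_d -> 'M['F_2]_(k, k * d)).
Hypothesis unitB : stacked B \in unitmx.
Variable delta : 'I_d -> nat -> 'F_2.

(** The only index difference whose prefix digits are those of a carry
starting at position [a j] in coordinate [j]; positions [a j >= k] stand for a
carry that starts in the tail. *)
Definition step_vector (a : 'I_d -> nat) : 'cV['F_2]_(k * d) :=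
  block_solution unitB (fun j => \col_r step (a j) r).

Definition step_tail (a : 'I_d -> nat) : 'cV['F_2]_(#|{: 'I_d * 'I_L}|) :=
  tail_target L (fun j s => step (a j) (k + s)).

Lemma step_vector_digits G a :
  tail_matrix L G *m step_vector a = step_tail a <->
  forall j r, (r < k + L)%N ->
    (rows B G j r *m step_vector a) ord0 ord0 = step (a j) r.
Proof.
rewrite tail_matrixP; split=> H j r rL.
  have [rk|kr] := ltnP r k.
    by rewrite (rows_head B G j _ (Ordinal rk)) block_solutionE mxE.
  by rewrite -(subnKC kr) rows_tail H // ltn_subLR.
by rewrite -(rows_tail B) H // ltn_add2l.
Qed.

(** The difference of the indices of the two close points is the witness: its
prefix is a carry pattern in every coordinate, and the prefix determines it.
*)
Lemma close_pair_pattern G : (1 < #|{: 'cV['F_2]_(k * d)}|)%N ->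
  separation (tail_points B delta G : _ -> 'rV[R]_d) < 2 ^- (k + L) ->
  exists a : {ffun 'I_d -> 'I_(k + L).+1},
    step_vector (fun j => a j) != 0 /\
    tail_matrix L G *m step_vector (fun j => a j) = step_tail (fun j => a j).
Proof.
move=> T2 /(separation_lt_pair T2)[v [v' [vv' close]]].
have xorE (y y' : 'F_2) : y + y' = y' - y.
  by case: (F2_cases y) (F2_cases y') => -> [] ->; apply/val_inj.
have pat j : exists a : 'I_(k + L).+1, forall r, (r < k + L)%N ->
    (rows B G j r *m (v' - v)) ord0 ord0 = step a r.
  have /(le_lt_trans (row_coord_le _ j)) := close; rewrite !mxE.
  move=> /binary_value_close[a aL H].
  exists (inord a) => r rL; rewrite inordK ?ltnS // /step -H // xorE.
  rewrite -/(digits B delta G v' j) -/(digits B delta G v j).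
  have := digitsD B delta G v (v' - v) j r; rewrite (addrC v) subrK => ->.
  by rewrite addrAC subrr add0r.
have [a aP] : exists a : {ffun 'I_d -> 'I_(k + L).+1}, forall j r, (r < k + L)%N ->
    (rows B G j r *m (v' - v)) ord0 ord0 = step (a j) r.
  exists [ffun j => projT1 (cid (pat j))] => j r rL; rewrite ffunE.
  exact: (projT2 (cid (pat j))).
have e : v' - v = step_vector (fun j => a j).
  apply: block_solution_unique => j; apply/matrixP => r c.
  rewrite (ord1 c) -(rows_head B G) [RHS]mxE aP //.
  exact: leq_trans (ltn_ord r) (leq_addr _ _).
exists a; rewrite -e; split; first by rewrite subr_eq0 eq_sym.
by rewrite e; apply/step_vector_digits => j r rL; rewrite -e aP.
Qed.

(** From position [a j] on, the prefix digits of the shifted point read [0 1 1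
... 1], so that flipping them is the carry of an increment by one. *)
Definition carry_ready (a : 'I_d -> nat) (v : 'cV['F_2]_(k * d)) : bool :=
  [forall j, forall r : 'I_k,
     (a j <= r)%N ==> ((B j *m v) r ord0 + delta j r == (a j < r)%N%:R)].

(** The tail of [G v] for which the shifted digits of the point are all ones.
*)
Definition ones_tail : 'cV['F_2]_(#|{: 'I_d * 'I_L}|) :=
  tail_target L (fun j s => 1 + delta j (k + s)%N).

(** Adding [step_vector a] to [v] is a carry in all the coordinates at once,
and moves each of them to the next cell of side [2 ^- (k + L)]. *)
Lemma carry_pair_close G (a : 'I_d -> nat) v : (0 < d)%N ->
  (forall j, (a j < k)%N) ->
  tail_matrix L G *m step_vector a = step_tail a ->
  carry_ready a v -> tail_matrix L G *m v = ones_tail ->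
  separation (tail_points B delta G : _ -> 'rV[R]_d) <= 2 * 2 ^- (k + L).
Proof.
move=> d0 ak /step_vector_digits Hw /forallP Hv /tail_matrixP Ht.
have w0 : v != v + step_vector a.
  rewrite -[X in X != _]addr0 (inj_eq (addrI v)) eq_sym; apply/eqP => w0.
  pose j := Ordinal d0.
  have := block_solutionE unitB (fun j => \col_r step (a j) r) j.
  rewrite -/(step_vector a) w0 mulmx0 => /matrixP/(_ (Ordinal (ak j)) ord0).
  by rewrite !mxE /step leqnn => /(congr1 val).
apply: le_trans (separation_le _ w0) _; apply: row_norm_le => [|j].
  by rewrite mulr_ge0 ?invr_ge0 ?exprn_ge0.
rewrite !mxE; apply: binary_value_dist_succ.
rewrite -/(digits B delta G v j) -/(digits B delta G (v + step_vector a) j).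
have addKK (x y : 'F_2) : x + y + y = x.
  by case: (F2_cases x) (F2_cases y) => -> [] ->; apply/val_inj.
have dig r : (a j <= r < k + L)%N -> digits B delta G v j r = (a j < r)%N%:R.
  move=> /andP[ar rL]; rewrite /digits /shifted_digits; have [rk|kr] := ltnP r k.
    rewrite (rows_head B G j _ (Ordinal rk)).
    by have /forallP/(_ (Ordinal rk))/implyP/(_ ar)/eqP := Hv j.
  rewrite -(subnKC kr) rows_tail Ht ?ltn_subLR // subnKC // addKK.
  by rewrite (leq_trans (ak j) kr).
apply: (@carry_succ _ _ (a j)) => [|||r rL].
- by rewrite (leq_trans (ak j)) ?leq_addr.
- by rewrite dig ?ltnn // leqnn (leq_trans (ak j)) ?leq_addr.
- by move=> r /andP[ar rL]; rewrite dig ?ar // ltnW.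
- by rewrite digitsD Hw.
Qed.

End Patterns.

(** * Counting the favourable tails *)

Lemma card_exists_le (T I : finType) (E : I -> {set T}) (p : pred I) :
  (#|[set t : T | [exists (i | p i), t \in E i]]%SET| <= \sum_(i | p i) #|E i|)%N.
Proof.
rewrite -sum1_card; rewrite [leqRHS](eq_bigr (fun i => \sum_(t in E i) 1%N)); last first.
  by move=> i _; rewrite sum1_card.
rewrite (exchange_big_dep predT) //= big_mkcond /=; apply: leq_sum => t _.
rewrite inE; case: ifP => // /existsP[i /andP[pi ti]].
by rewrite (bigD1 i) ?pi.
Qed.

Lemma tail_rows_card (d L : nat) : #|{: 'I_d * 'I_L}| = (d * L)%N.
Proof. by rewrite card_prod !card_ord. Qed.

Section PatternCounts.
Variables (d k L : nat) (B : 'I_d -> 'M['F_2]_(k, k * d)).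
Hypothesis unitB : stacked B \in unitmx.
Variable delta : 'I_d -> nat -> 'F_2.

Let M : finType := 'M['F_2]_(#|{: 'I_d * 'I_L}|, k * d).

(** The tails for which a pair of points may be closer than [2 ^- (k + L)]. *)
Definition close_set : {set M} :=
  [set H : M | [exists a : {ffun 'I_d -> 'I_(k + L).+1},
     (step_vector unitB (fun j => a j) != 0) &&
     (H *m step_vector unitB (fun j => a j) == step_tail k L (fun j => a j))]]%SET.

(** Union bound over the [(k + L).+1 ^ d] carry patterns. *)
Lemma card_close_set :
  (#|close_set| * 2 ^ (d * L) <= (k + L).+1 ^ d * #|M|)%N.
Proof.
pose E (a : {ffun 'I_d -> 'I_(k + L).+1}) : {set M} :=
  [set H : M | H *m step_vector unitB (fun j => a j) == step_tail k L (fun j => a j)]%SET.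
pose p (a : {ffun 'I_d -> 'I_(k + L).+1}) := step_vector unitB (fun j => a j) != 0.
have sub : (#|close_set| <= \sum_(a | p a) #|E a|)%N.
  apply: leq_trans (card_exists_le E p); apply: subset_leq_card.
  apply/fintype.subsetP => H; rewrite !inE => /existsP[a aP].
  by apply/existsP; exists a; rewrite inE.
rewrite (leq_trans (leq_mul sub (leqnn _))) // big_distrl /=.
rewrite (eq_bigr (fun=> #|M|)) => [|a pa]; last by rewrite -(tail_rows_card d L) card_hit1.
rewrite sum_nat_const leq_mul2r; apply/orP; right.
by rewrite (leq_trans (max_card _)) // card_ffun !card_ord.
Qed.

Variable h : nat.

Let deep (a : {ffun 'I_d -> 'I_k}) := [forall j, (h <= a j)%N].

(** The tails that produce a pair within [2 * 2 ^- (k + L)] by a carry. *)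
Definition carry_set : {set M} :=
  [set H : M | [exists a : {ffun 'I_d -> 'I_k},
     (H *m step_vector unitB (fun j => a j) == step_tail k L (fun j => a j)) &&
     [exists v, carry_ready B delta (fun j => a j) v
                && (H *m v == ones_tail k L delta)]]]%SET.

Lemma card_deep : (h <= k)%N -> #|[set a | deep a]%SET| = ((k - h) ^ d)%N.
Proof.
move=> hk; rewrite -[X in (_ ^ X)%N](card_ord d).
have -> : (k - h)%N = #|[pred r : 'I_k | (h <= r)%N]|.
  rewrite -sum1_card -[LHS]muln1 -sum_nat_const_nat.
  by rewrite (big_nat_widenl _ 0%N) // big_mkord.
rewrite -card_ffun_on; apply: eq_card => a; rewrite !inE.
by apply/forallP/ffun_onP.
Qed.

Lemma step_tail_deep (a : {ffun 'I_d -> 'I_k}) :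
  step_tail k L (fun j => a j) = tail_target L (fun _ _ => 1).
Proof.
apply/matrixP => i c; rewrite !mxE /step.
by rewrite (leq_trans (ltnW (ltn_ord _))) ?leq_addr.
Qed.

Lemma step_vector_inj (a b : {ffun 'I_d -> 'I_k}) :
  step_vector unitB (fun j => a j) = step_vector unitB (fun j => b j) -> a = b.
Proof.
move=> ab; apply/ffunP => j; apply/val_inj/eqP; rewrite eqn_leq /=.
have H r : step (a j) (r : 'I_k) = step (b j) r.
  have := block_solutionE unitB (fun j => \col_r step (a j) r) j.
  rewrite -/(step_vector unitB (fun j => a j)) ab block_solutionE.
  by move=> /matrixP/(_ r ord0); rewrite !mxE.
have := H (a j); have := H (b j); rewrite /step !leqnn.
by do 2![case: ifP => //= _]; rewrite ?andbT.
Qed.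

Lemma step_vector_neq0 (a : {ffun 'I_d -> 'I_k}) : (0 < d)%N ->
  step_vector unitB (fun j => a j) != 0.
Proof.
move=> d0; apply/eqP => w0; pose j := Ordinal d0.
have := block_solutionE unitB (fun j => \col_r step (a j) r) j.
rewrite -/(step_vector unitB (fun j => a j)) w0 mulmx0.
by move=> /matrixP/(_ (a j) ord0); rewrite !mxE /step leqnn => /(congr1 val).
Qed.

(** The first [h] digits of each coordinate are not constrained, since all the
carries start at [h] or later; these free digits [f] parametrize admissible
vectors. *)
Lemma card_carry_ready (a : {ffun 'I_d -> 'I_k}) : deep a ->
  ((2 ^ h) ^ d <= #|[set v | carry_ready B delta (fun j => a j) v]%SET|)%N.
Proof.
move=> /forallP ha.
pose free (f : {ffun 'I_d -> 'cV['F_2]_h}) (j : 'I_d) : 'cV['F_2]_k :=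
  \col_r (if insub (r : nat) is Some s then f j s ord0
          else (a j < r)%N%:R + delta j r).
have addKK (x y : 'F_2) : x + y + y = x.
  by case: (F2_cases x) (F2_cases y) => -> [] ->; apply/val_inj.
pose g f := block_solution unitB (free f).
have g_inj : injective g.
  move=> f1 f2 g12; apply/ffunP => j; apply/matrixP => s c; rewrite (ord1 c).
  have sk : (s < k)%N.
    by rewrite (leq_trans (ltn_ord s)) // (leq_trans (ha j)) // ltnW.
  have := block_solutionE unitB (free f1) j; rewrite -/(g f1) g12 block_solutionE.
  by move=> /matrixP/(_ (Ordinal sk) ord0); rewrite !mxE /= valK.
have -> : ((2 ^ h) ^ d = #|[set: {ffun 'I_d -> 'cV['F_2]_h}]%SET|)%N.
  by rewrite cardsT card_ffun card_M2 muln1 card_ord.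
rewrite -(card_imset _ g_inj); apply: subset_leq_card.
apply/fintype.subsetP => _ /imsetP[f _ ->]; rewrite inE.
apply/forallP => j; apply/forallP => r; apply/implyP => ar.
rewrite block_solutionE mxE insubN ?addKK // -leqNgt.
exact: leq_trans (ha j) ar.
Qed.

(** A tail outside [carry_set] either sends no deep [step_vector] to the all-
ones tail, or, for some deep [a], sends no admissible nonzero [v] to
[ones_tail]; both are second moment estimates, and the union over [a] costs a
factor [k ^ d] only on the second, much smaller, term. *)
Lemma card_carry_set (R : realType) : (0 < d)%N -> (0 < h)%N -> (h < k)%N ->
  #|~: carry_set|%:R / #|M|%:R <=
  2 ^+ (d * L) / (k - h)%:R ^+ d
  + k%:R ^+ d * (2 ^+ (d * L) / (2 ^+ (h * d) - 1)) :> R.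
Proof.
move=> d0 h0 hk.
pose w a := step_vector unitB (fun j => (a : {ffun 'I_d -> 'I_k}) j).
pose one : 'cV['F_2]_(#|{: 'I_d * 'I_L}|) := tail_target L (fun _ _ => 1).
pose W := (w @: [set a | deep a])%SET.
pose miss_w := [set H : M | [forall (v | v \in W), H *m v != one]]%SET.
pose V (a : {ffun 'I_d -> 'I_k}) :=
  [set v | (v != 0) && carry_ready B delta (fun j => a j) v]%SET.
pose miss_v a :=
  [set H : M | [forall (v | v \in V a), H *m v != ones_tail k L delta]]%SET.
have M0 : 0 < #|M|%:R :> R by rewrite ltr0n card_M2 expn_gt0.
have cw : (#|miss_w| * (k - h) ^ d <= 2 ^ (d * L) * #|M|)%N.
  have <- : #|W| = ((k - h) ^ d)%N.
    by rewrite card_imset; [exact: card_deep (ltnW hk)|exact: step_vector_inj].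
  rewrite -(tail_rows_card d L).
  apply: card_miss; apply/imsetP => -[a _ /esym/eqP]; apply/negP.
  exact: step_vector_neq0.
have cv a : deep a -> (#|miss_v a| * ((2 ^ h) ^ d - 1) <= 2 ^ (d * L) * #|M|)%N.
  move=> da; have V0 : 0 \notin V a by rewrite inE eqxx.
  rewrite -(tail_rows_card d L); apply: leq_trans (card_miss (ones_tail k L delta) V0).
  rewrite leq_mul2l; apply/orP; right; rewrite leq_subLR.
  apply: leq_trans (card_carry_ready da) _.
  rewrite (cardsD1 0) leq_add ?leq_b1 // subset_leq_card //.
  by apply/fintype.subsetP => v; rewrite !inE.
(* A failure of the carry construction is a failure of one of the two steps. *)
have sub : (#|~: carry_set| <= #|miss_w| + \sum_(a | deep a) #|miss_v a|)%N.
  apply: leq_trans (leq_add (leqnn _) (card_exists_le miss_v deep)).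
  apply: leq_trans (leq_card_setU _ _); apply: subset_leq_card.
  apply/fintype.subsetP => H; rewrite !inE negb_exists => /forallP nH.
  have [//|/= /forallPn[v]] := boolP [forall (v | v \in W), H *m v != one].
  rewrite negb_imply negbK => /andP[/imsetP[a]]; rewrite inE => da -> /eqP Ha.
  apply/existsP; exists a; rewrite da inE; apply/forallP => u; apply/implyP.
  rewrite inE => /andP[u0 ru]; move: (nH a).
  rewrite step_tail_deep -/one -/(w a) Ha eqxx /= negb_exists => /forallP/(_ u).
  by rewrite ru.
have kh : 0 < (k - h)%:R ^+ d :> R by rewrite exprn_gt0 // ltr0n subn_gt0.
have hd2 : (1 < (2 ^ h) ^ d)%N.
  by rewrite -expnM -{1}(expn0 2) ltn_exp2l // muln_gt0 h0.
have hd1 : 0 < 2 ^+ (h * d) - 1 :> R.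
  by rewrite subr_gt0 -natrX ltr1n expnM.
rewrite ler_pdivrMr // mulrDl.
apply: (@le_trans _ _ (#|miss_w|%:R + \sum_(a | deep a) #|miss_v a|%:R)).
  by rewrite -natr_sum -natrD ler_nat.
apply: lerD.
  rewrite mulrAC ler_pdivlMr // -!natrX -!natrM ler_nat.
  exact: cw.
apply: (@le_trans _ _ (\sum_(a | deep a) (2 ^+ (d * L) / (2 ^+ (h * d) - 1) * #|M|%:R))).
  apply: ler_sum => a /cv; rewrite -(ler_nat R) !natrM natrB ?(ltnW hd2) //.
  by rewrite !natrX -exprM mulrAC ler_pdivlMr.
rewrite sumr_const -[leLHS]mulr_natl -[leRHS]mulrA ler_wpM2r //.
  by rewrite mulr_ge0 ?ler0n // divr_ge0 ?exprn_ge0 // ltW.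
rewrite -natrX ler_nat (leq_trans (max_card _)) // card_ffun !card_ord //.
Qed.

End PatternCounts.

(** * The law of the tail matrix *)

Section TailLaw.
Variables (R : realType) (d k L : nat).
Variables (dO : measure_display) (Omega : measurableType dO).
Variables (P : probability Omega R) (B : 'I_d -> 'M['F_2]_(k, k * d)).
Variable G : Omega -> 'I_d -> nat -> 'rV['F_2]_(k * d).
Hypothesis model : affine_tail_model P B G.

Let M : finType := 'M['F_2]_(#|{: 'I_d * 'I_L}|, k * d).

(** The event is a finite intersection of independent events on single
entries, each of probability [1 / 2]. *)
Lemma tail_matrix_law (H : M) :
  measurable [set w | tail_matrix L (G w) = H] /\
  P [set w | tail_matrix L (G w) = H] = ((#|M|%:R)^-1 : R)%:E.
Proof.
case: model => _ mG uG indG; move: mG uG indG.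
set entry := fun (i : 'I_d * nat * 'I_(k * d)) w => G w i.1.1 i.1.2 ord0 i.2.
move=> mG uG indG.
pose emb (p : 'I_#|{: 'I_d * 'I_L}| * 'I_(k * d)) : 'I_d * nat * 'I_(k * d) :=
  (((enum_val p.1).1, (enum_val p.1).2 : nat), p.2).
have emb_inj : injective emb.
  move=> [i c] [i' c'] [e1 e2 ->]; congr (_, _); apply: enum_val_inj.
  by rewrite [LHS]surjective_pairing e1 (val_inj e2) -surjective_pairing.
pose A i : set 'F_2 := [set y | forall p, emb p = i -> y = H p.1 p.2].
have AE p : A (emb p) = [set H p.1 p.2].
  by apply/seteqP; split=> y /=; [exact|move=> -> p' /emb_inj->].
pose s := [seq emb p | p <- enum {: 'I_#|{: 'I_d * 'I_L}| * 'I_(k * d)}].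
have eventE : [set w | tail_matrix L (G w) = H]
    = \bigcap_(i in [set` s]) (entry i @^-1` A i).
  apply/seteqP; split=> w /=.
    by move=> Hw _ /mapP[p _ ->] /= p' /emb_inj->; rewrite -Hw mxE.
  move=> Hw; apply/matrixP => i c; rewrite mxE.
  have es : emb (i, c) \in s by apply: map_f; rewrite mem_enum.
  exact: (Hw _ es (i, c) erefl).
split.
  rewrite eventE; apply: fin_bigcap_measurable => [|i _]; first exact: finite_seq.
  exact: mG.
rewrite eventE indG; last by rewrite map_inj_uniq ?enum_uniq.
rewrite /s big_map big_enum /=.
rewrite (eq_bigr (fun=> (2^-1 : R)%:E)) => [|p _]; last by rewrite AE uG card_Fp.
rewrite prodEFin prodr_const card_prod !card_ord exprVn -natrX.
by rewrite card_M2.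
Qed.

Lemma tail_matrix_event (A : {set M}) :
  measurable [set w | tail_matrix L (G w) \in A] /\
  P [set w | tail_matrix L (G w) \in A] = (#|A|%:R / #|M|%:R : R)%:E.
Proof.
suff H (s : seq M) : uniq s -> measurable [set w | tail_matrix L (G w) \in s] /\
    P [set w | tail_matrix L (G w) \in s] = ((size s)%:R / #|M|%:R : R)%:E.
  have [] := H (enum A) (enum_uniq _); rewrite -cardE.
  by under eq_set do rewrite mem_enum.
elim: s => [_|h s IHs /= /andP[hs /IHs[ms Ps]]].
  have -> : [set w | tail_matrix L (G w) \in [::]] = set0 by apply/seteqP; split.
  by rewrite measure0 mul0r.
have [mh Ph] := tail_matrix_law h.
have -> : [set w | tail_matrix L (G w) \in h :: s]
    = [set w | tail_matrix L (G w) = h] `|` [set w | tail_matrix L (G w) \in s].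
  apply/seteqP; split=> w /=; rewrite inE.
    by case/orP => [/eqP|]; [left|right].
  by case=> [->|->]; rewrite ?eqxx ?orbT.
split; first exact: measurableU.
transitivity (P [set w | tail_matrix L (G w) = h]
              + P [set w | tail_matrix L (G w) \in s])%E.
  apply: measureU => //; apply/seteqP; split=> w //= [->].
  by rewrite (negbTE hs).
by rewrite Ph Ps -EFinD -natr1 mulrDl mul1r addrC.
Qed.

End TailLaw.

(** * Measurability *)

Section MeasurableFunctions.
Context {R : realType} {dO : measure_display} {Omega : measurableType dO}.

Lemma measurable_set_lt (f g : Omega -> R) :
  measurable_fun setT f -> measurable_fun setT g ->
  measurable [set w | f w < g w].
Proof.
move=> mf mg; have := measurable_fun_ltr mf mg measurableT (Y := [set true]).
by rewrite setTI; apply.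
Qed.

Lemma measurable_fun_gt_sets (f : Omega -> R) :
  (forall c, measurable [set w | c < f w]) -> measurable_fun setT f.
Proof.
move=> mf mD; apply: (measurability _ (RGenOInfty.measurableE R)) => //.
move=> /= _ [_ [c ->] <-]; apply: measurableI => //.
by rewrite preimage_itvoy.
Qed.

Lemma measurable_fun_lt_sets (f : Omega -> R) :
  (forall c, measurable [set w | f w < c]) -> measurable_fun setT f.
Proof.
move=> mf mD; apply: (measurability _ (RGenInftyO.measurableE R)) => //.
move=> /= _ [_ [c ->] <-]; apply: measurableI => //.
by rewrite preimage_itvNyo.
Qed.

Lemma measurable_inf_finite (I : finType) (D : set I) (f : I -> Omega -> R) :
  D !=set0 -> (forall i w, 0 <= f i w) ->
  (forall i, measurable_fun setT (f i)) ->
  measurable_fun setT (fun w => inf [set f i w | i in D]).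
Proof.
move=> [i0 Di0] f0 mf; apply: measurable_fun_lt_sets => c.
have -> : [set w | inf [set f i w | i in D] < c]
    = \bigcup_(i in D) [set w | f i w < c].
  apply/seteqP; split=> w /=.
    by move=> /inf_lt[|_ [i Di <-] fc]; [exists (f i0 w), i0|exists i].
  move=> [i Di] /=; apply: le_lt_trans; apply: ge_inf; last by exists i.
  by exists 0 => _ [j _ <-].
apply: fin_bigcup_measurable => [|i _]; first exact: finite_finset.
exact: measurable_set_lt.
Qed.

Lemma measurable_norm_row (d : nat) (f : Omega -> 'rV[R]_d) :
  (forall j, measurable_fun setT (fun w => f w ord0 j)) ->
  measurable_fun setT (fun w => `|f w|).
Proof.
move=> mf.
have m (s : seq ('I_1 * 'I_d)) : measurable_fun setT
    (fun w => \big[Num.max/0]_(p <- s) `|f w p.1 p.2| : R).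
  elim: s => [|p s IHs].
    by under eq_fun do rewrite big_nil; exact: measurable_cst.
  under eq_fun do rewrite big_cons; apply: measurable_maxr IHs.
  by apply: measurableT_comp => //; rewrite (ord1 p.1).
by have := m (index_enum _); under [X in _ -> measurable_fun _ X]eq_fun do
  rewrite [`|_|]mx_normrE.
Qed.

Section RandomPoints.
Variables (d : nat) (T : finType) (x : Omega -> T -> 'rV[R]_d).
Hypothesis mx : forall n j, measurable_fun setT (fun w => x w n ord0 j).

Lemma measurable_separation : (1 < #|T|)%N ->
  measurable_fun setT (fun w => separation (x w)).
Proof.
move=> T2; apply: (measurable_inf_finite
    (f := fun (p : T * T) w => `|x w p.1 - x w p.2|)) => [|//|p].
  exact: has_pair.
apply: measurable_norm_row => j.
by under eq_fun do rewrite !mxE; exact: measurable_funB.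
Qed.

Let nearest w (z : 'rV[R]_d) : R := inf [set `|z - x w n| | n in [set: T]].

Let measurable_nearest (n0 : T) z : measurable_fun setT (nearest ^~ z).
Proof.
apply: (measurable_inf_finite (f := fun n w => `|z - x w n|)) => [|//|n].
  by exists n0.
apply: measurable_norm_row => j; under eq_fun do rewrite !mxE.
by apply: measurable_funB => //; exact: measurable_cst.
Qed.

Let nearest_lipschitz (n0 : T) w z z' : nearest w z <= nearest w z' + `|z - z'|.
Proof.
rewrite -lerBlDr; apply: nearest_ge => // n; rewrite lerBlDr.
apply: (@le_trans _ _ `|z - x w n|).
  by apply: ge_inf; [exists 0 => _ [m _ <-]|exists n].
by rewrite -[z in leLHS](subrK z') -addrA addrC ler_normD.
Qed.

(** The supremum over the cube may be restricted to the countable set of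
points with coordinates [i / N.+1]: the distance to the nearest point is
1-Lipschitz, and rounding down does not leave the cube. *)
Lemma measurable_covering_radius (n0 : T) (c : R) :
  (forall w z, unit_cube z -> exists n, `|z - x w n| <= c) ->
  measurable_fun setT (fun w => covering_radius (x w)).
Proof.
move=> cover; apply: measurable_fun_gt_sets => b.
(* The countable dense family of nodes, with its mesh. *)
pose z (i : nat * {ffun 'I_d -> nat}) : 'rV[R]_d :=
  \row_j ((i.2 j)%:R / i.1.+1%:R).
have -> : [set w | b < covering_radius (x w)]
    = \bigcup_i [set w | unit_cube (z i) /\ b < nearest w (z i)].
  apply/seteqP; split=> w /=; last first.
    by move=> [i _ [zc bz]]; apply/(covering_radius_gt (cover w)); exists (z i).
  move=> /(covering_radius_gt (cover w))[y yc by_].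
  have [N bN] := ltr_add_invr by_.
  pose i := (N, [ffun j => Num.truncn (y ord0 j * N.+1%:R)]).
  have N0 : 0 < N.+1%:R :> R by rewrite ltr0n.
  have zy j : z i ord0 j <= y ord0 j <= z i ord0 j + N.+1%:R^-1.
    have /andP[y0 y1] := yc j; rewrite mxE ffunE /=.
    have /andP[t1 t2] := truncn_itv (mulr_ge0 y0 (ltW N0)).
    rewrite ler_pdivrMr // t1 /= -[X in _ + X]mul1r -mulrDl ler_pdivlMr //.
    by rewrite natr1 ltW.
  exists i => //; split=> [j|].
    have /andP[z1 z2] := zy j; have /andP[y0 y1] := yc j.
    by rewrite (le_trans z1 y1) mxE divr_ge0 ?ler0n.
  rewrite -(ltrD2r N.+1%:R^-1); apply: lt_le_trans bN _.
  apply: le_trans (nearest_lipschitz n0 w y (z i)) _; rewrite lerD2l.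
  apply: row_norm_le => [|j]; first by rewrite invr_ge0 ltW.
  have /andP[z1 z2] := zy j; rewrite !mxE in z1 z2 *.
  move: z1 z2; move: (_ / _) => a; move: (_^-1) (y _ _) => e t z1 z2.
  by rewrite ler_norml; apply/andP; split; lra.
apply: countable_bigcupT_measurable => // i.
have [zc|zc] := pselect (unit_cube (z i)).
  rewrite (_ : [set w | _] = [set w | b < nearest w (z i)]).
    by apply: measurable_set_lt => //; exact: measurable_nearest.
  by apply/seteqP; split=> w //= [].
by rewrite (_ : [set w | _] = set0) //; apply/seteqP; split=> w //= [].
Qed.

End RandomPoints.
End MeasurableFunctions.

Section MeasurableTail.
Variables (R : realType) (d k : nat).
Variables (dO : measure_display) (Omega : measurableType dO).
Variables (P : probability Omega R) (B : 'I_d -> 'M['F_2]_(k, k * d)).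
Variable delta : 'I_d -> nat -> 'F_2.
Variable G : Omega -> 'I_d -> nat -> 'rV['F_2]_(k * d).
Hypothesis model : affine_tail_model P B G.

Lemma measurable_row_fun j s (f : 'rV['F_2]_(k * d) -> R) :
  measurable_fun setT (fun w => f (G w j s)).
Proof.
case: model => _ mG _ _ _ Y _; rewrite setTI.
have -> : (fun w => f (G w j s)) @^-1` Y
    = \bigcup_(t in f @^-1` Y) [set w | G w j s = t].
  by apply/seteqP; split=> w /=; [exists (G w j s)|case=> t Yt ->].
apply: fin_bigcup_measurable => [|t _]; first exact: finite_finset.
have -> : [set w | G w j s = t]
    = \bigcap_(c in [set: 'I_(k * d)]) [set w | G w j s ord0 c = t ord0 c].
  apply/seteqP; split=> w /=; first by move=> Gt c _; rewrite /= Gt.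
  by move=> Gt; apply/matrixP => i c; rewrite (ord1 i); exact: Gt.
apply: fin_bigcap_measurable => [|c _]; first exact: finite_finset.
exact: (mG (j, s, c) [set t ord0 c]).
Qed.

(** A coordinate is a pointwise limit of partial sums, which depend on
finitely many random entries. *)
Lemma measurable_tail_points v j :
  measurable_fun setT (fun w => (tail_points B delta (G w) v : 'rV[R]_d) ord0 j).
Proof.
under eq_fun do rewrite mxE.
pose dig w := shifted_digits (stack_rows (B j) (G w j)) v (delta j).
apply: (measurable_fun_cvg
  (h := fun n w => series (fun r => (dig w r : nat)%:R * 2 ^- r.+1) n)).
  move=> n; under eq_fun do rewrite seriesEnat /=; apply: measurable_sum => r.
  apply: measurable_funM; last exact: measurable_cst.
  rewrite /dig /shifted_digits /stack_rows.
  case: insubP => [i _ _|_]; first exact: measurable_cst.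
  exact: (measurable_row_fun j (r - k)
    (fun u => (nat_of_ord ((u *m v) ord0 ord0 + delta j r)%R)%:R)).
move=> w _; exact: is_cvg_binary.
Qed.

End MeasurableTail.

(** * Tail bounds for the separation *)

Section SeparationTails.
Variables (R : realType) (d k : nat).
Variables (dO : measure_display) (Omega : measurableType dO).
Variables (P : probability Omega R) (B : 'I_d -> 'M['F_2]_(k, k * d)).
Variable delta : 'I_d -> nat -> 'F_2.
Variable G : Omega -> 'I_d -> nat -> 'rV['F_2]_(k * d).
Hypothesis model : affine_tail_model P B G.
Hypotheses (d0 : (0 < d)%N) (k0 : (0 < k)%N).

Let x w : _ -> 'rV[R]_d := tail_points B delta (G w).
Let sep w : R := separation (x w).

Let unitB : stacked B \in unitmx.
Proof. by case: model. Qed.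

Lemma card_index_gt1 : (1 < #|{: 'cV['F_2]_(k * d)}|)%N.
Proof. by rewrite card_M2 muln1 -{1}(expn0 2) ltn_exp2l // muln_gt0 k0. Qed.

Lemma measurable_sep : measurable_fun setT sep.
Proof.
apply: measurable_separation card_index_gt1 => v j.
exact: measurable_tail_points model _ _.
Qed.

Lemma measurable_covering :
  measurable_fun setT (fun w => covering_radius (x w)).
Proof.
apply: (@measurable_covering_radius _ _ _ _ _ _ _ 0 (2 ^- k)) => [v j|w z].
  exact: measurable_tail_points model _ _.
exact: cell_has_point unitB _.
Qed.

Lemma separation_lower_tail (L : nat) :
  (P [set w | (sep w < 2 ^- (k + L))%R] <= (((k + L).+1%:R / 2 ^+ L) ^+ d)%:E)%E.
Proof.
have [mA PA] := tail_matrix_event model (close_set L unitB).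
apply: (@le_trans _ _ (P [set w | tail_matrix L (G w) \in close_set L unitB])).
  apply: le_measure; rewrite ?inE //.
    by apply: measurable_set_lt => //; exact: measurable_sep.
  move=> w /= /(close_pair_pattern unitB card_index_gt1)[a [a0 Ha]].
  by rewrite inE; apply/existsP; exists a; rewrite a0 Ha eqxx.
rewrite PA lee_fin ler_pdivrMr; last by rewrite ltr0n card_M2 expn_gt0.
rewrite expr_div_n mulrAC ler_pdivlMr; last by rewrite -exprM exprn_gt0.
by rewrite -exprM -!natrX -!natrM ler_nat mulnC [(L * d)%N]mulnC mulnC card_close_set.
Qed.

Lemma separation_upper_tail (L h : nat) : (0 < h)%N -> (h < k)%N ->
  (P [set w | (sep w > 2 * 2 ^- (k + L))%R] <=
   (2 ^+ (d * L) / (k - h)%:R ^+ d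
    + k%:R ^+ d * (2 ^+ (d * L) / (2 ^+ (h * d) - 1)))%:E)%E.
Proof.
move=> h0 hk; pose A := (~: carry_set L unitB delta)%SET.
have [mA PA] := tail_matrix_event model A.
apply: (@le_trans _ _ (P [set w | tail_matrix L (G w) \in A])).
  apply: le_measure; rewrite ?inE //.
    by apply: measurable_set_lt => //; exact: measurable_sep.
  move=> w /=; rewrite ltNge => /negP sepw; rewrite !inE; apply/negP.
  move=> /existsP[a /andP[/eqP Ha /existsP[v /andP[av /eqP Hv]]]]; apply: sepw.
  exact: (carry_pair_close _ d0 _ Ha av Hv).
by rewrite PA lee_fin card_carry_set.
Qed.

End SeparationTails.

Lemma pow2_bracket (R : realType) (t : R) : 1 <= t ->
  exists L : nat, 2 ^+ L <= t < 2 ^+ L.+1.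
Proof.
move=> t1; have t0 : 0 <= t := le_trans ler01 t1.
have /andP[n1 n2] := truncn_itv t0.
have n0 : (0 < Num.truncn t)%N by rewrite truncn_gt0.
have /andP[L1 L2] := trunc_log_bounds (isT : 1 < 2)%N n0.
exists (trunc_log 2 (Num.truncn t)); rewrite -!natrX; apply/andP; split.
  by apply: le_trans n1; rewrite ler_nat.
by apply: lt_le_trans n2 _; rewrite ler_nat.
Qed.

(** Here [2 ^ L] is about [8 u k], hence at most [2 k ^ 2], so that [L] is at
most linear in [k] and the number of positions [k + L + 1] is of the order of
[k]. *)
Lemma lower_tail_numeric (R : realType) (d k L : nat) (u : R) :
  (0 < k)%N -> 1 <= u <= k%:R / 4 ->
  2 ^+ L <= 8 * u * k%:R < 2 ^+ L.+1 ->
  ((k + L).+1%:R / 2 ^+ L) ^+ d <= u ^- d.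
Proof.
move=> k0 /andP[u1 uk] /andP[L1 L2].
have kR : 0 < k%:R :> R by rewrite ltr0n.
have u0 : 0 < u := lt_le_trans ltr01 u1.
have k4 : (4 <= k)%N by rewrite -(ler_nat R); lra.
have kL : ((k + L).+1 <= 4 * k)%N.
  suff : (L < k + k + 2)%N by lia.
  rewrite -(ltn_exp2l _ _ (isT : 1 < 2)%N) 2!expnD.
  have k2 : (k < 2 ^ k)%N by exact: ltn_expl.
  apply: (@leq_ltn_trans (k * k * 2)); last first.
    by move: k2; rewrite (erefl : 2 ^ 2 = 4)%N; move: (2 ^ k)%N => m; nia.
  by rewrite -(ler_nat R) natrX !natrM; nra.
rewrite -(exprVn u); apply: lerXn2r;
  rewrite ?nnegrE ?divr_ge0 ?exprn_ge0 ?invr_ge0 ?(ltW u0) //.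
rewrite ler_pdivrMr ?exprn_gt0 // mulrC ler_pdivlMr //.
move: kL; rewrite -(ler_nat R) natrM => kL.
move: L2; rewrite exprS; move: kL; move: (2 ^+ L) ((k + L).+1%:R) => p q kL L2.
nra.
Qed.

Lemma sqr_le_pow2 (h : nat) : (h * h <= 2 * 2 ^ h)%N.
Proof.
case: h => [|[|[|h]]] //; elim: h => // h IHh.
by rewrite expnS; nia.
Qed.

(** The threshold [h = k./2] balances the number of deep patterns, [(k - h) ^
d], and the number of free digits, [h * d]. *)
Lemma half_bounds (k : nat) : (4 <= k)%N ->
  [/\ (2 <= k./2)%N, (k./2 < k)%N, (k <= 2 * (k - k./2))%N & (k <= 3 * k./2)%N].
Proof. by move=> k4; split; lia. Qed.

(** With [2 ^ L <= k / (2 u)] and [k - h >= k / 2] the first term is at most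
[u ^- d]; the second one is at most [2 (k ^ 2 / (2 u 2 ^ h)) ^ d], where [k ^
2 <= 18 * 2 ^ h]. *)
Lemma upper_tail_numeric (R : realType) (d k L : nat) (u : R) :
  (0 < d)%N -> 1 <= u <= k%:R / 4 -> 2 ^+ L <= k%:R / (2 * u) ->
  [/\ (0 < k./2)%N, (k./2 < k)%N &
  2 ^+ (d * L) / (k - k./2)%:R ^+ d
    + k%:R ^+ d * (2 ^+ (d * L) / (2 ^+ (k./2 * d) - 1)) <= 3 * 9 ^+ d * u ^- d].
Proof.
move=> d0 /andP[u1 uk] HL; have u0 : 0 < u := lt_le_trans ltr01 u1.
have k4 : (4 <= k)%N by rewrite -(ler_nat R); lra.
have kR : 0 < k%:R :> R by rewrite ltr0n; lia.
have [h2 hk k2 k3] := half_bounds k4; set h := k./2 in h2 hk k2 k3 *.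
split => //; first exact: ltnW.
have {}HL : 2 ^+ L * (2 * u) <= k%:R :> R by rewrite -ler_pdivlMr // mulr_gt0.
have p0 : 0 < 2 ^+ L :> R by rewrite exprn_gt0.
have kh : 0 < (k - h)%:R :> R by rewrite ltr0n subn_gt0.
have t1 : 2 ^+ (d * L) / (k - h)%:R ^+ d <= u ^- d :> R.
  rewrite mulnC exprM -expr_div_n -(exprVn u).
  apply: lerXn2r; rewrite ?nnegrE ?divr_ge0 ?invr_ge0 ?(ltW u0) ?(ltW p0) //.
  rewrite ler_pdivrMr // mulrC ler_pdivlMr //.
  by move: k2; rewrite -(ler_nat R) natrM; lra.
have t2 : k%:R ^+ d * (2 ^+ (d * L) / (2 ^+ (h * d) - 1)) <= 2 * (9 ^+ d * u ^- d) :> R.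
  have H0 : 0 < 2 ^+ h :> R by rewrite exprn_gt0.
  have H1 : 2 <= (2 ^+ h) ^+ d :> R.
    by rewrite -exprM -[leLHS]expr1 (ler_eXn2l (ltr1n R 2)) muln_gt0 d0 (ltnW h2).
  apply: (@le_trans _ _ (2 * (k%:R * 2 ^+ L / 2 ^+ h) ^+ d)).
    rewrite [(d * L)%N]mulnC !exprM expr_div_n exprMn [leLHS]mulrA [leRHS]mulrCA.
    apply: ler_wpM2l; first by rewrite mulr_ge0 ?exprn_ge0 ?(ltW p0) ?(ltW kR).
    move: H1; move: ((2 ^+ h) ^+ d) => q q2.
    rewrite -[leLHS]mul1r ler_pdivrMr; last by lra.
    by rewrite mulrAC ler_pdivlMr; lra.
  rewrite ler_wpM2l // -(exprVn u) -exprMn; apply: lerXn2r;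
    rewrite ?nnegrE ?mulr_ge0 ?invr_ge0 ?(ltW u0) ?(ltW p0) ?(ltW H0) ?(ltW kR) //.
  rewrite ler_pdivrMr // mulrAC ler_pdivlMr //.
  have : (k * k <= 18 * 2 ^ h)%N.
    rewrite (leq_trans (leq_mul k3 k3)) // mulnACA.
    by move: (sqr_le_pow2 h); move: (h * h)%N (2 ^ h)%N; clear; lia.
  rewrite -(ler_nat R) !natrM natrX => kk.
  have : k%:R * (2 ^+ L * (2 * u)) <= k%:R * k%:R :> R by rewrite ler_pM2l.
  by lra.
have e9 : 1 <= 9 ^+ d :> R by rewrite exprn_ege1 // ler1n.
have ud : 0 < u ^- d by rewrite invr_gt0 exprn_gt0.
have : u ^- d <= 9 ^+ d * u ^- d by rewrite ler_peMl // ltW.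
by rewrite -mulrA; lra.
Qed.

(** The thresholds of the theorem are rounded to powers of two, in the
direction that enlarges the events. *)
Lemma scale_separation_events (R : realType) (k : nat) (u : R) : (0 < k)%N ->
  1 <= u <= k%:R / 4 ->
  (exists2 L : nat, 2 ^+ L <= 8 * u * k%:R < 2 ^+ L.+1 &
     (8 * u)^-1 * (2 ^- k / k%:R) <= 2 ^- (k + L)) /\
  (exists2 L : nat, 2 ^+ L <= k%:R / (2 * u) &
     2 * 2 ^- (k + L) <= 8 * u * (2 ^- k / k%:R)).
Proof.
move=> k0 /andP[u1 uk]; have kR : 1 <= k%:R :> R by rewrite ler1n.
have u0 : 0 < u := lt_le_trans ltr01 u1.
have q0 : 0 < 2 ^- k :> R by rewrite invr_gt0 exprn_gt0.
have expE L : 2 ^- (k + L) = 2 ^- k / 2 ^+ L :> R by rewrite exprD invfM.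
split.
  have [|L HL] := @pow2_bracket R (8 * u * k%:R); first by nra.
  exists L => //; rewrite expE mulrCA ler_wpM2l ?(ltW q0) // -invfM.
  have /andP[L1 _] := HL.
  by rewrite lef_pV2 // posrE ?exprn_gt0 // !mulr_gt0 // ltr0n.
have [|L /andP[L1 L2]] := @pow2_bracket R (k%:R / (2 * u)).
  by rewrite ler_pdivlMr ?mulr_gt0 //; lra.
exists L => //; rewrite expE mulrCA [leRHS]mulrCA ler_wpM2l ?(ltW q0) //.
have p0 : 0 < 2 ^+ L :> R by rewrite exprn_gt0.
rewrite ler_pdivrMr // mulrAC ler_pdivlMr; last by rewrite ltr0n.
move: L2; rewrite ltr_pdivrMr ?mulr_gt0 // exprS; lra.
Qed.

Lemma separation_tails (R : realType) (d k : nat)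
    (dO : measure_display) (Omega : measurableType dO) (P : probability Omega R)
    (B : 'I_d -> 'M['F_2]_(k, k * d)) (delta : 'I_d -> nat -> 'F_2)
    (G : Omega -> 'I_d -> nat -> 'rV['F_2]_(k * d)) (u : R) :
  (0 < d)%N -> (0 < k)%N -> affine_tail_model P B G -> 1 <= u <= k%:R / 4 ->
  (P [set w | (separation (tail_points B delta (G w) : _ -> 'rV[R]_d)
              < (8 * u)^-1 * (2 ^- k / k%:R))%R]
     <= (3 * 9 ^+ d * u ^- d)%:E)%E /\
  (P [set w | (separation (tail_points B delta (G w) : _ -> 'rV[R]_d)
              > 8 * u * (2 ^- k / k%:R))%R]
     <= (3 * 9 ^+ d * u ^- d)%:E)%E.
Proof.
move=> d0 k0 model u1k; have /andP[u1 _] := u1k.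
have [[L HL lowL] [L' HL' upL']] := scale_separation_events k0 u1k.
have ms := measurable_sep delta model d0 k0.
split.
  apply: (@le_trans _ _ (P [set w | (separation (tail_points B delta (G w)
      : _ -> 'rV[R]_d) < 2 ^- (k + L))%R])).
    apply: le_measure; rewrite ?inE; [exact: measurable_set_lt|exact: measurable_set_lt|].
    by move=> w /= /lt_le_trans; apply.
  apply: le_trans (separation_lower_tail delta model d0 k0 L) _; rewrite lee_fin.
  apply: le_trans (lower_tail_numeric d k0 u1k HL) _.
  have e9 : 1 <= 9 ^+ d :> R by rewrite exprn_ege1 // ler1n.
  by rewrite ler_peMl ?invr_ge0 ?exprn_ge0 //; lra.
have [h0 hk num] := upper_tail_numeric d0 u1k HL'.
apply: (@le_trans _ _ (P [set w | (separation (tail_points B delta (G w)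
    : _ -> 'rV[R]_d) > 2 * 2 ^- (k + L'))%R])).
  apply: le_measure; rewrite ?inE; [exact: measurable_set_lt|exact: measurable_set_lt|].
  by move=> w /=; apply: le_lt_trans.
by apply: le_trans (separation_upper_tail delta model d0 k0 L' h0 hk) _; rewrite lee_fin.
Qed.

(** * Probabilistic orders *)

Lemma bigTheta_P_scale (R : realType) (d : nat -> measure_display)
    (Omega : forall k, measurableType (d k))
    (P : forall k, probability (Omega k) R)
    (X : forall k, Omega k -> \bar R) (a : nat -> R) (c : R) : 0 < c ->
  bigTheta_P P X a -> bigTheta_P P X (fun k => c * a k).
Proof.
move=> c0 [XO XW]; split=> eps eps0.
  have [C [k0 [C0 H]]] := XO eps eps0.
  exists (C / c), k0; split=> [|k k0k]; first exact: divr_gt0.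
  by rewrite mulrA divfK ?lt0r_neq0 //; exact: H.
have [C [k0 [C0 H]]] := XW eps eps0.
exists (C * c), k0; split=> [|k k0k]; first exact: mulr_gt0.
suff E w : ((C * c * 1)%:E < `|(c * a k)%:E / X k w|)%E
    = ((C * 1)%:E < `|(a k)%:E / X k w|)%E.
  by under eq_set do rewrite E; exact: H.
rewrite !mulr1 [(C * c)%R]mulrC !EFinM -muleA abseM (@gee0_abs _ c%:E).
  by rewrite lte_pmul2l ?lte_fin.
by rewrite lee_fin ltW.
Qed.

Section MeshRatio.
Context {R : realType} {d : nat} {T : finType}.
Variable x : T -> 'rV[R]_d.
Hypotheses (sep0 : 0 <= separation x) (cov0 : 0 < covering_radius x).

(** Clearing denominators turns the extended-real event into a comparison of
measurable real functions; a vanishing separation is on the right side because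
the covering radius is positive. *)
Lemma mesh_ratio_gt (c : R) : 0 <= c ->
  (c%:E < `|mesh_ratio x|)%E <-> c * separation x < 2 * covering_radius x.
Proof.
move=> c0; rewrite /mesh_ratio; case: eqP => [->|/eqP sn].
  by rewrite /= ltry mulr0 mulr_gt0.
have sp : 0 < separation x by rewrite lt_def sn.
rewrite abse_EFin ger0_norm ?divr_ge0 ?mulr_ge0 ?(ltW cov0) // lte_fin.
by rewrite ltr_pdivlMr.
Qed.

Lemma div_mesh_ratio_gt (a c : R) : 0 < a -> 0 <= c ->
  (c%:E < `|a%:E / mesh_ratio x|)%E <-> 2 * covering_radius x * c < a * separation x.
Proof.
move=> a0 c0; have cov2 : 0 < 2 * covering_radius x by rewrite mulr_gt0.
rewrite /mesh_ratio; case: eqP => [->|/eqP sn].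
  rewrite invey mule0 abse0 lte_fin mulr0; split=> [|h]; first by rewrite ltNge c0.
  by have := mulr_ge0 (ltW cov2) c0; rewrite leNgt h.
have sp : 0 < separation x by rewrite lt_def sn.
rewrite inver mulf_eq0 invr_eq0 (negbTE sn) orbF (gt_eqF cov2) -EFinM.
rewrite abse_EFin ger0_norm; last by rewrite mulr_ge0 ?invr_ge0 ?divr_ge0 // ltW.
by rewrite lte_fin invf_div mulrA ltr_pdivlMr // mulrC.
Qed.

End MeshRatio.

Lemma div_separation_gt (R : realType) (d : nat) (T : finType)
    (x : T -> 'rV[R]_d) (a c : R) : 0 <= separation x -> 0 < a -> 0 < c ->
  (c%:E < `|a%:E / (separation x)%:E|)%E <-> separation x < c^-1 * a.
Proof.
move=> s0 a0 c0; rewrite inver; case: eqP => [->|/eqP sn].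
  by rewrite gt0_muley ?lte_fin //= ltry mulr_gt0 ?invr_gt0.
have sp : 0 < separation x by rewrite lt_def sn.
rewrite -EFinM abse_EFin ger0_norm ?divr_ge0 ?(ltW a0) // lte_fin.
by rewrite ltr_pdivlMr // ltr_pdivlMl.
Qed.

Section Orders.
Variables (R : realType) (d : nat).
Hypothesis d0 : (0 < d)%N.
Variables (dO : nat -> measure_display) (Omega : forall k, measurableType (dO k)).
Variable P : forall k, probability (Omega k) R.
Variable B : forall k, 'I_d -> 'M['F_2]_(k, k * d).
Variable delta : forall k : nat, 'I_d -> nat -> 'F_2.
Variable G : forall k, Omega k -> 'I_d -> nat -> 'rV['F_2]_(k * d).
Hypothesis model : forall k, (1 <= k)%N -> affine_tail_model (P k) (B k) (@G k).

Let x k (w : Omega k) : _ -> 'rV[R]_d := tail_points (B k) (delta k) (@G k w).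
Let sep k (w : Omega k) : R := separation (x w).

(** As [d >= 1], the tail bound [3 * 9 ^ d * u ^- d] is at most any given
[eps] for [u] large, and the constraint [u <= k / 4] holds for [k] large. *)
Lemma eventually_small_tails (eps : R) : 0 < eps ->
  exists (u : R) (k0 : nat), 0 < u /\ forall k, (k0 <= k)%N ->
  [/\ (1 <= k)%N,
      (P k [set w | (sep w < (8 * u)^-1 * (2 ^- k / k%:R))%R] <= eps%:E)%E
    & (P k [set w | (8 * u * (2 ^- k / k%:R) < sep w)%R] <= eps%:E)%E].
Proof.
move=> eps0; pose C : R := 3 * 9 ^+ d; pose u := 1 + C / eps.
have C0 : 0 < C by rewrite mulr_gt0 ?exprn_gt0.
have q0 : 0 < C / eps by rewrite divr_gt0.
have u1 : 1 <= u by rewrite /u; lra.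
have u0 : 0 < u := lt_le_trans ltr01 u1.
have small : C * u ^- d <= eps.
  rewrite ler_pdivrMr ?exprn_gt0 // mulrC -ler_pdivrMr //.
  apply: (@le_trans _ _ u); first by rewrite /u; lra.
  by rewrite -[leLHS]expr1 ler_weXn2l.
exists u, (Num.truncn (4 * u)).+1; split=> // k uk.
have u4 : 0 <= 4 * u by rewrite mulr_ge0 // ltW.
have uk' : 4 * u < k%:R.
  have /andP[_ h] := truncn_itv u4; apply: lt_le_trans h _.
  by rewrite ler_nat.
have k1 : (1 <= k)%N by exact: leq_ltn_trans uk.
have ukR : 1 <= u <= k%:R / 4 by rewrite u1 ler_pdivlMr //; lra.
have [lo up] := separation_tails (delta k) d0 k1 (model k1) ukR.
by split=> //; [apply: le_trans lo _|apply: le_trans up _]; rewrite lee_fin.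
Qed.

Let sep_ge0 k (w : Omega k) : (1 <= k)%N -> 0 <= sep w.
Proof. by move=> k1; apply: separation_ge0; exact: card_index_gt1. Qed.

Lemma scale_gt0 k : (1 <= k)%N -> 0 < 2 ^- k / k%:R :> R.
Proof. by move=> k1; rewrite divr_gt0 ?invr_gt0 ?exprn_gt0 // ltr0n. Qed.

Lemma separation_order :
  bigTheta_P P (fun k w => (sep w)%:E) (fun k => 2 ^- k / k%:R).
Proof.
split=> eps /eventually_small_tails[u [k0 [u0 H]]];
  exists (8 * u), k0; split=> [|k /H[k1 lo up]]; try exact: mulr_gt0.
  rewrite (_ : [set w | _] = [set w | 8 * u * (2 ^- k / k%:R) < sep w]) //.
  by apply/seteqP; split=> w /=; rewrite lte_fin ger0_norm // sep_ge0.
rewrite (_ : [set w | _] = [set w | sep w < (8 * u)^-1 * (2 ^- k / k%:R)]) //.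
have u8 : 0 < 8 * u by rewrite mulr_gt0.
by apply/seteqP; split=> w /=; rewrite mulr1;
  have [lr rl] := div_separation_gt (sep_ge0 w k1) (scale_gt0 k1) u8;
    [exact: lr|exact: rl].
Qed.

(** The covering radius lies between [2 ^- k / 2] and [2 ^- k], so that a
large (small) mesh ratio forces a small (large) separation. *)
Lemma mesh_ratio_order :
  bigTheta_P P (fun k w => mesh_ratio (x w)) (fun k => k%:R).
Proof.
have unitB k : (1 <= k)%N -> stacked (B k) \in unitmx by move=> /model[].
have covB k (w : Omega k) (k1 : (1 <= k)%N) :=
  covering_radius_bounds R (delta k) (@G k w) (unitB k k1) d0.
have cov0 k (w : Omega k) : (1 <= k)%N -> 0 < covering_radius (x w).
  move=> /(covB _ w)/andP[+ _]; apply: lt_le_trans.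
  by rewrite divr_gt0 ?invr_gt0 ?exprn_gt0.
have mcov k (k1 : (1 <= k)%N) := measurable_covering (delta k) (model k1).
have msep k (k1 : (1 <= k)%N) := measurable_sep (delta k) (model k1) d0 k1.
split=> eps /eventually_small_tails[u [k0 [u0 H]]].
  exists (16 * u), k0; split=> [|k /H[k1 lo up]]; first exact: mulr_gt0.
  apply: le_trans lo; have kR : 0 < k%:R :> R by rewrite ltr0n.
  have uk : 0 < 16 * u * k%:R by rewrite !mulr_gt0.
  rewrite (_ : [set w | _]
      = [set w | 16 * u * k%:R * sep w < 2 * covering_radius (x w)]).
    apply: le_measure; rewrite ?inE.
    - apply: measurable_set_lt; apply: measurable_funM => //.
      + exact: msep.
      + exact: mcov.
    - by apply: measurable_set_lt => //; exact: msep.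
    move=> w /= /lt_le_trans h; have /andP[_ c2] := covB k w k1.
    have {}h : 16 * u * k%:R * sep w < 2 * 2 ^- k.
      by apply: h; rewrite ler_wpM2l.
    rewrite mulrCA -invfM ltr_pdivlMr ?mulr_gt0 //.
    by move: h; move: (sep w) (2 ^- k) => s q; lra.
  by apply/seteqP; split=> w /=;
  have [lr rl] := mesh_ratio_gt (sep_ge0 w k1) (cov0 k w k1) (ltW uk);
    [exact: lr|exact: rl].
exists (8 * u), k0; split=> [|k /H[k1 lo up]]; first exact: mulr_gt0.
apply: le_trans up; have kR : 0 < k%:R :> R by rewrite ltr0n.
have u8 : 0 < 8 * u by rewrite mulr_gt0.
rewrite (_ : [set w | _]
    = [set w | 2 * covering_radius (x w) * (8 * u) < k%:R * sep w]).
  apply: le_measure; rewrite ?inE.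
  - apply: measurable_set_lt; do ?apply: measurable_funM => //.
    + exact: mcov.
    + exact: msep.
  - by apply: measurable_set_lt => //; exact: msep.
  move=> w /= h; have /andP[c1 _] := covB k w k1.
  have {}h : 2 ^- k * (8 * u) < k%:R * sep w.
    apply: le_lt_trans h; rewrite ler_wpM2r ?(ltW u8) //; lra.
  by rewrite mulrA ltr_pdivrMr // mulrC [ltRHS]mulrC.
by apply/seteqP; split=> w /=; rewrite mulr1;
  have [lr rl] := div_mesh_ratio_gt (sep_ge0 w k1) (cov0 k w k1) kR (ltW u8);
    [exact: lr|exact: rl].
Qed.

End Orders.

Lemma pow2_exponent (R : realType) (d k : nat) : (0 < d)%N ->
  2 ^- k = 2 `^ (- ((k * d)%:R / d%:R)) :> R.
Proof.
move=> d0; rewrite natrM mulfK ?pnatr_eq0 -?lt0n // powRN powR_mulrn //.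
Qed.

Theorem theorem5p11 (R : realType) (d : nat) (hd : (1 <= d)%N) :
  [/\ (* tail bounds, uniform over the model *)
      exists (C : R) (k0 : nat), 0 < C /\
      forall k : nat, (1 <= k)%N -> (k0 <= k)%N ->
      forall (dO : measure_display) (Omega : measurableType dO)
             (P : probability Omega R)
             (B : 'I_d -> 'M['F_2]_(k, k * d))
             (delta : 'I_d -> nat -> 'F_2)
             (G : Omega -> 'I_d -> nat -> 'rV['F_2]_(k * d)),
        affine_tail_model P B G ->
      forall u : R, 1 <= u <= k%:R / 4 ->
        (P [set w | (separation (tail_points B delta (G w) : _ -> 'rV[R]_d)
                    < (8 * u)^-1 * (2 ^- k / k%:R))%R]
           <= (C * u ^- d)%:E)%E /\
        (P [set w | (separation (tail_points B delta (G w) : _ -> 'rV[R]_d)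
                    > 8 * u * (2 ^- k / k%:R))%R]
           <= (C * u ^- d)%:E)%E,
      (* probabilistic orders, along any sequence of models *)
      forall (dO : nat -> measure_display)
             (Omega : forall k, measurableType (dO k))
             (P : forall k, probability (Omega k) R)
             (B : forall k, 'I_d -> 'M['F_2]_(k, k * d))
             (delta : forall k, 'I_d -> nat -> 'F_2)
             (G : forall k, Omega k -> 'I_d -> nat -> 'rV['F_2]_(k * d)),
        (forall k, (1 <= k)%N -> affine_tail_model (P k) (B k) (G k)) ->
        let X k w : 'cV['F_2]_(k * d) -> 'rV[R]_d :=
          tail_points (B k) (delta k) (G k w) in
        [/\ bigTheta_P P (fun k w => (separation (X k w))%:E)
              (fun k => 2 ^- k / k%:R),
            bigTheta_P P (fun k w => (separation (X k w))%:E)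
              (fun k => 2 `^ (- ((k * d)%:R / d%:R)) * (k * d)%:R^-1),
            bigTheta_P P (fun k w => mesh_ratio (X k w)) (fun k => k%:R)
          & bigTheta_P P (fun k w => mesh_ratio (X k w))
              (fun k => (k * d)%:R)]
    & (* covering radius, for every outcome *)
      exists c1 c2 : R, [/\ 0 < c1, 0 < c2 &
      forall k : nat, (1 <= k)%N ->
      forall (dO : measure_display) (Omega : measurableType dO)
             (P : probability Omega R)
             (B : 'I_d -> 'M['F_2]_(k, k * d))
             (delta : 'I_d -> nat -> 'F_2)
             (G : Omega -> 'I_d -> nat -> 'rV['F_2]_(k * d)),
        affine_tail_model P B G ->
        2 ^- k = 2 `^ (- ((k * d)%:R / d%:R)) :> R /\
        forall w : Omega,
          c1 * 2 ^- k
          <= covering_radius (tail_points B delta (G w) : _ -> 'rV[R]_d)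
          <= c2 * 2 ^- k]].
Proof.
split.
- exists (3 * 9 ^+ d), 0%N; split; first by rewrite mulr_gt0 ?exprn_gt0.
  by move=> k k1 _ dO Omega P B delta G model u; exact: separation_tails.
- move=> dO Omega P B delta G model X.
  have so := separation_order hd delta model.
  have mo := mesh_ratio_order hd delta model.
  have d1 : 0 < d%:R :> R by rewrite ltr0n.
  split=> //.
    have d1' : 0 < d%:R^-1 :> R by rewrite invr_gt0.
    rewrite (_ : (fun k : nat => _ : R) = (fun k : nat => d%:R^-1 * (2 ^- k / k%:R))).
      exact: bigTheta_P_scale so.
    by apply/funext => k; rewrite -pow2_exponent // natrM (invfM k%:R) [LHS]mulrA mulrC.
  rewrite (_ : (fun k : nat => (k * d)%:R) = (fun k : nat => d%:R * k%:R : R)).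
    exact: bigTheta_P_scale mo.
  by apply/funext => k; rewrite natrM mulrC.
- exists (1 / 2), 1; split=> // k k1 dO Omega P B delta G [unitB _ _ _].
  split=> [|w]; first exact: pow2_exponent.
  by rewrite div1r [2^-1 * _]mulrC mul1r; exact: covering_radius_bounds.
Qed.
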